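(* Consider the random game $G(2,n)$ and let $S^C(2,n)$ be the number of Column's actions surviving iterated elimination of strictly dominated actions. Then, as $n\to\infty$, uniformly in $x\in\mathbb{R}$, $$\Pr\left(S^C(2,n)-\mathbb{E}\left[S^C(2,n)\right]\le x\cdot\sqrt{\operatorname{Var}\left[S^C(2,n)\right]}\right)=\Phi(x)+\mathcal{O}\left(\frac{1}{\sqrt{\ln n}}\right),$$ where $\Phi$ is the distribution function of the standard normal distribution, $$\mathbb{E}\left[S^C(2,n)\right]=\ln n+\gamma+o(1),\qquad \sqrt{\operatorname{Var}\left[S^C(2,n)\right]}=\sqrt{\ln n}-\frac{\pi^2-6\gamma}{12\sqrt{\ln n}}+o\left(\frac{1}{\sqrt{\ln n}}\right),$$ and $\gamma$ is the Euler–Mascheroni constant.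
   Context: Random game $G(m,n)$ ($m,n\ge1$ integers): there are two players, Row with action set $[m]=\{1,\dots,m\}$ and Column with action set $[n]$. Payoffs are given by $m\times n$ matrices $R=(r_{ij})$ (Row's payoffs) and $C=(c_{ij})$ (Column's payoffs). For each $j\in[n]$ the column $r_{\cdot j}=(r_{1j},\dots,r_{mj})$ is a uniformly random permutation of $[m]$; for each $i\in[m]$ the row $c_{i\cdot}=(c_{i1},\dots,c_{in})$ is a uniformly random permutation of $[n]$; all these $m+n$ random permutations are mutually independent. Dominance (by pure actions only): in a (sub)game with row set $Y\subseteq[m]$ and column set $X\subseteq[n]$, Row's action $i\in Y$ is strictly dominated if there is $i'\in Y$ with $r_{i'x}>r_{ix}$ for all $x\in X$; Column's action $j\in X$ is strictly dominated if there is $j'\in X$ with $c_{yj'}>c_{yj}$ for all $y\in Y$. Iterated elimination: in each round, both players simultaneously delete all their actions that are strictly dominated in the current subgame; the procedure stops when there are no strictly dominated actions. $S^C(m,n)$ denotes the (random) number of Column's actions that survive this procedure in $G(m,n)$. *)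

(* Defs.v *)
From HB Require Import structures.
From mathcomp Require Import all_boot all_order all_algebra all_fingroup.
From mathcomp Require Import all_classical all_reals all_analysis.
Import Order.TTheory GRing.Theory Num.Theory.
Import numFieldNormedType.Exports.
Set Implicit Arguments.
Unset Strict Implicit.
Unset Printing Implicit Defensive.

Local Open Scope classical_set_scope.
Local Open Scope ring_scope.

Section Dominance.
Variables (m n : nat) (r c : 'M[nat]_(m, n)).

Definition row_dominated (Y : {set 'I_m}) (X : {set 'I_n}) (i : 'I_m) : bool :=
  [exists i' in Y, [forall x in X, (r i x < r i' x)%N]].

Definition col_dominated (Y : {set 'I_m}) (X : {set 'I_n}) (j : 'I_n) : bool :=
  [exists j' in X, [forall y in Y, (c y j < c y j')%N]].

Definition elim_round (s : {set 'I_m} * {set 'I_n}) :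
    {set 'I_m} * {set 'I_n} :=
  ([set i in s.1 | ~~ row_dominated s.1 s.2 i]%SET,
   [set j in s.2 | ~~ col_dominated s.1 s.2 j]%SET).

(* Every round before the procedure stops deletes at least one of the m + n
   actions, so the procedure has stopped after m + n rounds; see
   [elim_round_surviving]. *)
Definition surviving : {set 'I_m} * {set 'I_n} :=
  iter (m + n) elim_round ([set: 'I_m], [set: 'I_n])%SET.

Lemma elim_round_surviving : elim_round surviving = surviving.
Proof.
pose w (s : {set 'I_m} * {set 'I_n}) := (#|s.1| + #|s.2|)%N.
have sub1 s : (elim_round s).1 \subset s.1.
  by apply/fintype.subsetP => i; rewrite inE => /andP[].
have sub2 s : (elim_round s).2 \subset s.2.
  by apply/fintype.subsetP => i; rewrite inE => /andP[].
have fix_or_drop s : elim_round s = s \/ (w (elim_round s) < w s)%N.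
  have [lt_w|ge_w] := ltnP (w (elim_round s)) (w s); [by right | left].
  have /subset_leq_card le1 := sub1 s; have /subset_leq_card le2 := sub2 s.
  have [e1 e2] : (#|s.1| <= #|(elim_round s).1|)%N /\
                 (#|s.2| <= #|(elim_round s).2|)%N.
    move: ge_w; rewrite /w => ge_w; split.
      by rewrite -(leq_add2r #|s.2|) (leq_trans ge_w)// leq_add2l.
    by rewrite -(leq_add2l #|s.1|) (leq_trans ge_w)// leq_add2r.
  have/eqP f1 : (elim_round s).1 == s.1 by rewrite eqEcard sub1.
  have/eqP f2 : (elim_round s).2 == s.2 by rewrite eqEcard sub2.
  by rewrite [LHS]surjective_pairing f1 f2 -surjective_pairing.
pose s k := iter k elim_round ([set: 'I_m], [set: 'I_n])%SET.
have bound k : elim_round (s k) = s k \/ (w (s k) + k <= m + n)%N.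
  elim: k => [|k [fixk|le_k]].
  - by right; rewrite /w /= !cardsT !card_ord addn0.
  - by left; rewrite /s iterS -/(s k) !fixk.
  - have [fixk|lt_w] := fix_or_drop (s k).
      by left; rewrite /s iterS -/(s k) !fixk.
    by right; rewrite addnS -addSn (leq_trans _ le_k)// leq_add2r.
have [//|le0] := bound (m + n)%N.
have /eqP w0 : w (s (m + n)%N) == 0%N.
  by rewrite -leqn0 -(leq_add2r (m + n)) add0n.
have [//|] := fix_or_drop (s (m + n)%N).
by rewrite w0 ltn0.
Qed.

End Dominance.

(* A realisation of G(m,n): the pair (sigma, tau) consists of the n columns
   sigma j of Row's payoff matrix and the m rows tau i of Column's. *)
Definition game (m n : nat) : Type :=
  ({ffun 'I_n -> 'S_m} * {ffun 'I_m -> 'S_n})%type.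

HB.instance Definition _ m n := Finite.on (game m n).
HB.instance Definition _ m n := isPointed.Build (game m n)
  ([ffun _ => 1%g], [ffun _ => 1%g]).
HB.instance Definition _ m n := @isMeasurable.Build default_measure_display
  (game m n) discrete_measurable discrete_measurable0
  discrete_measurableC discrete_measurableU.

(* Permutations act on 'I_k = {0, .., k-1}; the successor makes the payoffs
   range over {1, .., k}. *)
Definition row_payoffs m n (g : game m n) : 'M[nat]_(m, n) :=
  \matrix_(i < m, j < n) (g.1 j i).+1.

Definition col_payoffs m n (g : game m n) : 'M[nat]_(m, n) :=
  \matrix_(i < m, j < n) (g.2 i j).+1.

(* The uniform law on the product space [game m n] is the product of the m + n
   uniform laws on its factors, i.e. the law under which all these
   permutations are uniform and mutually independent. *)
Definition game_law (R : realType) (m n : nat) (A : set (game m n)) : \bar R :=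
  (#|[pred g | g \in A]|%:R / #|{: game m n}|%:R)%:E.

Section GameLaw.
Variables (R : realType) (m n : nat).

Lemma card_game_gt0 : (0 < #|{: game m n}|)%N.
Proof. by apply/card_gt0P; exists point. Qed.

Lemma game_lawE (A : set (game m n)) :
  game_law R A = (\sum_(g : game m n) (#|{: game m n}|%:R^-1)%:E * \d_g A)%E.
Proof.
rewrite /game_law -sum1_card natr_sum mulr_suml -sumEFin big_mkcond /=.
apply: eq_bigr => g _; rewrite diracE inE.
by case: (g \in A); rewrite ?mul1r ?mule1 ?mule0.
Qed.

Let law0 : game_law R (set0 : set (game m n)) = 0%E.
Proof. by rewrite game_lawE big1// => g _; rewrite measure0 mule0. Qed.

Let law_ge0 (A : set (game m n)) : (0 <= game_law R A)%E.
Proof. by rewrite lee_fin divr_ge0. Qed.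

Let law_sigma_additive : semi_sigma_additive (@game_law R m n).
Proof.
have inv_ge0 : 0 <= #|{: game m n}|%:R^-1 :> R by rewrite invr_ge0.
pose mu := mscale (NngNum inv_ge0)
  (msum (fun i => if insub i is Some j then \d_(enum_val (j : 'I_#|{: game m n}|))
                  else \d_(point : game m n)) #|{: game m n}|).
have -> : @game_law R m n = mu.
  apply/funext => A; rewrite game_lawE /mu /mscale /msum /=.
  rewrite -ge0_sume_distrr => [|g _]; last by [].
  congr (_ * _)%E.
  rewrite (eq_bigl (fun g => g \in [pred _ : game m n | true])) // big_enum_val.
  by apply: eq_bigr => i _; rewrite valK.
exact: measure_semi_sigma_additive.
Qed.

HB.instance Definition _ := isMeasure.Build _ _ _ (@game_law R m n)
  law0 law_ge0 law_sigma_additive.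

Let law_setT : game_law R [set: game m n] = 1%E.
Proof.
rewrite /game_law (eq_card (B := predT)); last first.
  by move=> g; rewrite inE in_setT.
by rewrite divff// pnatr_eq0 -lt0n card_game_gt0.
Qed.

HB.instance Definition _ := @Measure_isProbability.Build _ _ R
  (@game_law R m n) law_setT.

End GameLaw.

Definition random_game (R : realType) (m n : nat) : probability (game m n) R :=
  @game_law R m n.

Definition SC (R : realType) (m n : nat) (g : game m n) : R :=
  #|(surviving (row_payoffs g) (col_payoffs g)).2|%:R.

Definition mean_SC (R : realType) (m n : nat) : R :=
  fine 'E_(random_game R m n)[@SC R m n].

Definition var_SC (R : realType) (m n : nat) : R :=
  fine 'V_(random_game R m n)[@SC R m n].

Definition Phi (R : realType) (x : R) : R :=
  fine (normal_prob 0 1 `]-oo, x]%classic).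

(* series harmonic n = 1 + 1/2 + .. + 1/n *)
Definition euler_mascheroni (R : realType) : R :=
  lim ((series harmonic n - ln n%:R : R) @[n --> \oo]).

(* Main.v *)
Require Import Defs.
From HB Require Import structures.
From mathcomp Require Import all_boot all_order all_algebra all_fingroup.
From mathcomp Require Import all_classical all_reals all_analysis.
From mathcomp Require Import ring lra zify.
Import Order.TTheory GRing.Theory Num.Theory.
Import numFieldNormedType.Exports.

(* After the first round the surviving columns are the Pareto-undominated ones;
   their number K is the number of right-to-left maxima of a uniform
   permutation, i.e. a sum of independent Bernoulli(1/i), i = 1, .., n. If one
   of Row's actions is dominated on these K columns (conditional probability
   2^(1-K)), exactly one column survives in the end, otherwise all K do. Since
   E[(3/4)^K] <= exp (- H_n / 4), where H_n is the n-th harmonic number, this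
   perturbs the first two moments and the distribution function negligibly.
   The mean H_n and the variance H_n - sum 1/i^2 of K give the asymptotics of the
   moments (Euler's constant and the Basel sum), and a Berry-Esseen bound for K
   with rate 1 / sqrt (Var K) follows from Stein's method. *)

Set Implicit Arguments.
Unset Strict Implicit.
Unset Printing Implicit Defensive.

Local Open Scope classical_set_scope.
Local Open Scope ring_scope.

(** * The standard normal law *)

(** The law of [K] enters only through [bern], a recursion that computes expectations, so Stein's
    identity and the bounds on [K] are inductions on [n] and no probability space has to carry the
    Bernoulli variables. The base 3/4 leaves room above 1/2: the probability [2 / 2 ^+ k] of a
    collapse to one column, even multiplied by [k ^+ 2 + 1], stays below [10 * (3 / 4) ^+ k], so
    that one comparison serves the mean, the variance and the distribution function. The theorem
    standardises by the moments of S^C, the Berry-Esseen bound by those of [K]; passing between them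
    replaces [x] by [r * x + t], with [r - 1] and [t] of order 1 / sqrt (ln n). Since [(r - 1) * x]
    is unbounded in [x], uniformity rests on [|x| * phi x <= 1]. The 12 in the expansion of the
    standard deviation comes from sqrt (ln n + b) - sqrt (ln n) ~ b / (2 sqrt (ln n)) with b = gamma
    - pi^2 / 6. *)

Lemma mvt_le {R : realType} (f df : R -> R) (a b : R) : a <= b ->
  (forall x, a <= x <= b -> is_derive x 1 f (df x)) ->
  exists2 c, a <= c <= b & f b - f a = df c * (b - a).
Proof.
move=> ab fdf; have [||c] := @MVT_segment R f df a b ab.
- by move=> x; rewrite in_itv/= => /andP[ax xb]; apply: fdf; rewrite !ltW.
- apply: derivable_within_continuous => x; rewrite in_itv/= => axb.
  by have [] := fdf _ axb.
- by rewrite in_itv/=; exists c.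
Qed.

Section NormalLaw.
Variable R : realType.
Implicit Types x y z w : R.

Definition phi x : R := normal_pdf 0 1 x.

Lemma phiE x : phi x = normal_peak 1 * expR (- (x ^+ 2 / 2)).
Proof.
rewrite /phi normal_pdfE ?oner_neq0// /normal_fun subr0 expr1n.
by rewrite mulNr.
Qed.

Lemma phi_gt0 x : 0 < phi x.
Proof. by rewrite phiE mulr_gt0 ?expR_gt0// normal_peak_gt0// oner_neq0. Qed.

Lemma phi_ge0 x : 0 <= phi x.
Proof. exact/ltW/phi_gt0. Qed.

Lemma phi_le x y : `|x| <= `|y| -> phi y <= phi x.
Proof.
move=> xy; rewrite !phiE ler_wpM2l ?normal_peak_ge0// ler_expR lerN2.
by rewrite ler_pM2r ?invr_gt0// -(real_normK (num_real x))
  -(real_normK (num_real y)) lerXn2r ?nnegrE.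
Qed.

Lemma phi_le1 x : phi x <= 1.
Proof.
apply: (le_trans (@normal_pdf_ub R 0 1 x (oner_neq0 R))).
rewrite invf_le1 ?sqrtr_gt0; last by rewrite expr1n mul1r mulr2n; have := pi_gt0 R; lra.
rewrite -[leLHS]sqrtr1 ler_sqrt// ?expr1n ?mul1r; have := pi_ge2 R; rewrite mulr2n; lra.
Qed.

Lemma is_derive_phi x : is_derive x 1 phi (- (x * phi x)).
Proof.
have -> : phi = (fun x => normal_peak 1 * expR (- (x ^+ 2 / 2))).
  by apply/funext => ?; rewrite phiE.
apply: is_derive_eq; rewrite /GRing.scale/=.
by field.
Qed.

Lemma is_derive_Phi x : is_derive x 1 (@Phi R) (phi x).
Proof.
have := @continuous_FTC1 R (normal_pdf 0 1) -oo%O x (x + 1).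
case=> //.
- by rewrite ltrDl.
- apply: integrableS (integrable_normal_pdf 0 1) => //.
- exact: ltNyr.
- by move: x; apply: continuous_normal_pdf; exact: oner_neq0.
- move=> dF eF; apply: DeriveDef => //.
  by rewrite -derive1E.
Qed.

Let P : probability (measurableTypeR R) R := @normal_prob R 0 1.
Let X : measurableTypeR R -> R := idfun.
#[local] HB.instance Definition _ :=
  @isMeasurableFun.Build _ _ _ _ X (@measurable_id _ _ setT).

Let Phi_cdf x : cdf (X : {RV P >-> R}) x = (Phi x)%:E.
Proof. by rewrite /cdf /distribution /pushforward /Phi/= fineK// fin_num_measure. Qed.

Lemma Phi_ge0 x : 0 <= Phi x.
Proof. by rewrite -lee_fin -Phi_cdf cdf_ge0. Qed.

Lemma Phi_le1 x : Phi x <= 1.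
Proof. by rewrite -lee_fin -Phi_cdf cdf_le1. Qed.

Lemma cvg_Phiy : @Phi R x @[x --> +oo] --> (1 : R).
Proof.
have := @cvg_cdfy1 _ _ R P X.
have -> : cdf (X : {RV P >-> R}) = EFin \o @Phi R.
  by apply/funext => x; rewrite Phi_cdf.
by move=> /fine_cvgP[].
Qed.

Lemma cvg_PhiNy : @Phi R x @[x --> -oo] --> (0 : R).
Proof.
have := @cvg_cdfNy0 _ _ R P X.
have -> : cdf (X : {RV P >-> R}) = EFin \o @Phi R.
  by apply/funext => x; rewrite Phi_cdf.
by move=> /fine_cvgP[].
Qed.

Lemma Phi_mvt x y : x <= y -> exists2 c, x <= c <= y & Phi y - Phi x = phi c * (y - x).
Proof. by move=> xy; apply: mvt_le => // z _; exact: is_derive_Phi. Qed.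

Lemma Phi_homo x y : x <= y -> Phi x <= Phi y.
Proof.
move=> xy; have [c _ e] := Phi_mvt xy.
by rewrite -subr_ge0 e mulr_ge0 ?phi_ge0 ?subr_ge0.
Qed.

Lemma Phi_lipschitz x y : x <= y -> Phi y - Phi x <= y - x.
Proof.
move=> xy; have [c _ ->] := Phi_mvt xy.
by rewrite ler_piMl ?subr_ge0// phi_le1.
Qed.

Lemma is_derive_phi_ratio x : x != 0 ->
  is_derive x 1 (fun t => phi t / t) (- phi x - phi x / x ^+ 2).
Proof.
move=> x0; have dphi := is_derive_phi x.
have dV := @is_deriveV R id x 1 1 x0 (is_derive_id _ _).
apply: (is_derive_eq (is_deriveM dphi dV)).
rewrite /GRing.scale /=; by field.
Qed.

(** The derivative of [phi t / t + Phi t] is [- phi t / t ^+ 2], so the function decreases on each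
    side of 0. Sending one end to infinity yields the two Mills bounds. *)
Let mills_decr x y : (0 < x) || (y < 0) -> x <= y ->
  phi y / y + Phi y <= phi x / x + Phi x.
Proof.
move=> xy0 xy.
have [|c _ e] := @mvt_le R (fun t => phi t / t + Phi t)
    (fun t => - phi t - phi t / t ^+ 2 + phi t) x y xy.
  move=> t /andP[xt ty]; have dPhi := is_derive_Phi t.
  have t0 : t != 0.
    by case/orP: xy0 => ?; [rewrite gt_eqF//|rewrite lt_eqF//]; lra.
  by have := is_derive_phi_ratio t0; move=> d; apply: is_derive_eq.
rewrite -subr_le0 e addrAC addNr add0r mulNr oppr_le0.
by rewrite mulr_ge0 ?subr_ge0// divr_ge0 ?phi_ge0 ?sqr_ge0.
Qed.

Lemma mills_right w : 0 < w -> w * (1 - Phi w) <= phi w.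
Proof.
move=> w0; rewrite mulrC -ler_pdivlMr// lerBlDr.
apply: (cvgr_to_le cvg_Phiy); near=> b.
have wb : w <= b by near: b; apply: nbhs_pinfty_ge; rewrite num_real.
have b0 : 0 < b by exact: lt_le_trans wb.
apply: le_trans (mills_decr _ wb); last by rewrite w0.
by rewrite lerDr divr_ge0 ?phi_ge0// ltW.
Unshelve. all: by end_near. Qed.

Lemma mills_left w : w < 0 -> - w * Phi w <= phi w.
Proof.
move=> w0; suff : phi w / w + Phi w <= 0.
  move=> h; have := h; rewrite -(ler_nM2l w0) mulr0 mulrDr mulrCA divff ?lt_eqF// mulr1.
  by move=> ?; lra.
apply: (cvgr_to_ge cvg_PhiNy); near=> b.
have wb : b <= w by near: b; apply: nbhs_ninfty_le; rewrite num_real.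
have b0 : b < 0 by exact: le_lt_trans w0.
apply: le_trans (mills_decr _ wb) _; first by rewrite w0 orbT.
by rewrite gerDr mulr_ge0_le0 ?phi_ge0// invr_le0 ltW.
Unshelve. all: by end_near. Qed.

Lemma abs_phi_le1 w : `|w| * phi w <= 1.
Proof.
have pe : phi w <= expR (- (w ^+ 2 / 2)).
  rewrite phiE ler_piMl ?expR_ge0//.
  by have := phi_le1 0; rewrite phiE expr0n mul0r oppr0 expR0 mulr1.
have e1 : expR (- (w ^+ 2 / 2)) <= (1 + w ^+ 2 / 2)^-1.
  rewrite expRN lef_pV2 ?posrE ?expR_gt0 ?expR_ge1Dx//.
  by have := sqr_ge0 w; lra.
apply: le_trans (ler_wpM2l (normr_ge0 w) (le_trans pe e1)) _.
rewrite ler_pdivrMr ?mul1r; last by have := sqr_ge0 w; lra.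
rewrite -(real_normK (num_real w)); have := sqr_ge0 (`|w| - 1); lra.
Qed.
End NormalLaw.

(** * The solution of Stein's equation *)

Section SteinSolution.
Variables (R : realType) (z : R).
Implicit Types (w u d : R).

(** The bounded solution of [f' w = w * f w + 1_{w <= z} - Phi z]. The [min] and [max] merge its two
    branches, [Phi w * (1 - Phi z) / phi w] left of [z] and [Phi z * (1 - Phi w) / phi w] right of
    it. *)
Definition stein w : R := Phi (Num.min w z) * (1 - Phi (Num.max w z)) / phi w.

Definition stein_bound : R := (phi 1)^-1.

Lemma stein_bound_ge1 : 1 <= stein_bound.
Proof. by rewrite invf_ge1 ?phi_gt0// phi_le1. Qed.

Lemma stein_ge0 w : 0 <= stein w.
Proof. by rewrite divr_ge0 ?phi_ge0// mulr_ge0 ?Phi_ge0// subr_ge0 Phi_le1. Qed.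

Lemma stein_numerator_le w :
  Phi (Num.min w z) * (1 - Phi (Num.max w z)) <= Num.min (Phi w) (1 - Phi w).
Proof.
have [a0 b1] := (Phi_ge0 (Num.min w z), Phi_le1 (Num.max w z)).
have [a1 b0] := (Phi_le1 (Num.min w z), Phi_ge0 (Num.max w z)).
rewrite le_min; apply/andP; split.
  apply: (@le_trans _ _ (Phi (Num.min w z))); first by rewrite ler_piMr//; lra.
  by apply: Phi_homo; rewrite ge_min lexx.
apply: (@le_trans _ _ (1 - Phi (Num.max w z))); first by rewrite ler_piMl//; lra.
by rewrite lerD2l lerN2; apply: Phi_homo; rewrite le_max lexx.
Qed.

Lemma abs_stein_le1 w : `|w| * stein w <= 1.
Proof.
rewrite /stein mulrA ler_pdivrMr ?phi_gt0// mul1r.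
apply: le_trans (ler_wpM2l (normr_ge0 w) (stein_numerator_le w)) _.
have [w0|w0|->] := ltgtP w 0; last by rewrite normr0 mul0r phi_ge0.
- apply: le_trans (mills_left w0); rewrite ltr0_norm// ler_wpM2l ?oppr_ge0 ?(ltW w0)//.
  by rewrite ge_min lexx.
- apply: le_trans (mills_right w0); rewrite gtr0_norm// ler_wpM2l ?(ltW w0)//.
  by rewrite ge_min lexx orbT.
Qed.

Lemma stein_le w : stein w <= stein_bound.
Proof.
have [w1|w1] := lerP 1 `|w|.
  apply: le_trans stein_bound_ge1; apply: le_trans (abs_stein_le1 w).
  by rewrite ler_peMl ?stein_ge0.
rewrite /stein ler_pdivrMr ?phi_gt0//.
apply: (le_trans (stein_numerator_le w)); apply: (@le_trans _ _ 1).
  by rewrite ge_min Phi_le1.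
by rewrite /stein_bound mulrC ler_pdivlMr ?phi_gt0// mul1r phi_le// normr1 ltW.
Qed.

Lemma stein_mvt_left w u : w <= u -> u <= z ->
  exists2 c, w <= c <= u &
    stein u - stein w = (c * stein c + 1 - Phi z) * (u - w).
Proof.
move=> wu uz.
have left_eq t : t <= z -> stein t = Phi t * (1 - Phi z) / phi t.
  by move=> tz; rewrite /stein (min_idPl tz) (max_idPr tz).
have [|c wcu e] := @mvt_le R (fun t => Phi t * (1 - Phi z) / phi t)
  (fun t => t * (Phi t * (1 - Phi z) / phi t) + 1 - Phi z) w u wu.
- move=> t _; have p0 : phi t != 0 by rewrite gt_eqF// phi_gt0.
  have dP := is_derive_Phi t; have dp := is_deriveV p0 (is_derive_phi t).
  by apply: is_derive_eq; rewrite /GRing.scale/=; field.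
- have cz : c <= z by case/andP: wcu => _ cu; exact: le_trans cu uz.
  by exists c => //; rewrite !left_eq//; exact: le_trans wu uz.
Qed.

Lemma stein_mvt_right w u : w <= u -> z <= w ->
  exists2 c, w <= c <= u &
    stein u - stein w = (c * stein c - Phi z) * (u - w).
Proof.
move=> wu zw.
have right_eq t : z <= t -> stein t = Phi z * (1 - Phi t) / phi t.
  by move=> zt; rewrite /stein (min_idPr zt) (max_idPl zt).
have [|c wcu e] := @mvt_le R (fun t => Phi z * (1 - Phi t) / phi t)
  (fun t => t * (Phi z * (1 - Phi t) / phi t) - Phi z) w u wu.
- move=> t _; have p0 : phi t != 0 by rewrite gt_eqF// phi_gt0.
  have dP := is_derive_Phi t; have dp := is_deriveV p0 (is_derive_phi t).
  by apply: is_derive_eq; rewrite /GRing.scale/=; field.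
- have zc : z <= c by case/andP: wcu => wc _; exact: le_trans zw wc.
  by exists c => //; rewrite !right_eq//; exact: le_trans zw wu.
Qed.

(** [stein] has a kink at [z], so an interval around [z] is cut there and the mean value theorem is
    applied to each piece; [a] is the proportion of the interval lying left of [z]. *)
Lemma stein_split w u : w <= u -> exists a c c' : R,
  [/\ 0 <= a <= 1, w <= c <= u, w <= c' <= u,
      (u <= z -> a = 1) /\ (z < w -> a = 0) &
      stein u - stein w =
        (a * (c * stein c) + (1 - a) * (c' * stein c') + a - Phi z) * (u - w)].
Proof.
move=> wu; have [uz|zu] := leP u z.
  have [c wcu e] := stein_mvt_left wu uz; exists 1, c, c.
  split=> //; [lra | by split=> // zw; have := lt_le_trans zw (le_trans wu uz); rewrite ltxx|].
  by rewrite e; ring.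
have [wz|zw] := leP w z; last first.
  have [c wcu e] := stein_mvt_right wu (ltW zw); exists 0, c, c.
  by split=> //; [lra | rewrite e; ring].
have [c /andP[wc cz] e] := stein_mvt_left wz (lexx z).
have [c' /andP[zc cu] e'] := stein_mvt_right (ltW zu) (lexx z).
have uw : u - w != 0 by rewrite subr_eq0 gt_eqF//; lra.
exists ((z - w) / (u - w)), c, c'; split.
- by rewrite divr_ge0 ?ler_pdivrMr ?mul1r; lra.
- lra.
- lra.
- by split=> ?; lra.
- have -> : stein u - stein w = (stein u - stein z) + (stein z - stein w) by ring.
  by rewrite e e'; field.
Qed.

(** The slope is an average of two values [t * stein t], which lie in [-1, 1], plus [a - Phi z],
    which lies there too. *)
Lemma stein_lipschitz w u : w <= u -> `|stein u - stein w| <= 2 * (u - w).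
Proof.
move=> wu; have [a [c [c' [/andP[a0 a1] _ _ _ ->]]]] := stein_split wu.
rewrite normrM (ger0_norm (_ : 0 <= u - w)) ?subr_ge0// ler_wpM2r ?subr_ge0//.
have bnd t : -1 <= t * stein t <= 1.
  by rewrite -ler_norml normrM (ger0_norm (stein_ge0 t)) abs_stein_le1.
have /andP[l1 r1] := bnd c; have /andP[l2 r2] := bnd c'.
have P0 := Phi_ge0 z; have P1 := Phi_le1 z.
have lo : -1 <= a * (c * stein c) + (1 - a) * (c' * stein c') by nra.
have hi : a * (c * stein c) + (1 - a) * (c' * stein c') <= 1 by nra.
by rewrite ler_norml; lra.
Qed.

Lemma id_stein_lipschitz u c d : `|c - u| <= d ->
  `|c * stein c - u * stein u| <= d * (stein_bound + 2 * `|u|).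
Proof.
move=> cu; have -> : c * stein c - u * stein u =
  (c - u) * stein c + u * (stein c - stein u) by ring.
apply: (le_trans (ler_normD _ _)).
rewrite (normrM (c - u)) (normrM u (stein c - stein u)) mulrDr.
apply: lerD.
  by apply: ler_pM => //; rewrite (ger0_norm (stein_ge0 c)) stein_le.
have l : `|stein c - stein u| <= 2 * `|c - u|.
  have [uc|cu'] := leP u c.
    by rewrite (ger0_norm (_ : 0 <= c - u)) ?subr_ge0// stein_lipschitz.
  by rewrite distrC (distrC c) (ger0_norm (_ : 0 <= u - c)) ?stein_lipschitz ?subr_ge0// ltW.
have := ler_wpM2l (normr_ge0 u) (le_trans l (ler_wpM2l _ cu)); nra.
Qed.

(* Difference-quotient form of Stein's equation f' = w f + 1_{w <= z} - Phi z:
   over [w, w + d] the indicator is replaced by its average a. *)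
Lemma stein_step w d : 0 < d -> exists a e : R,
  [/\ (w + d <= z)%R%:R <= a, a <= (w <= z)%R%:R,
      stein (w + d) - stein w = (a + e - Phi z) * d
    & forall u, w <= u <= w + d ->
        `|e - u * stein u| <= d * (stein_bound + 2 * `|u|)].
Proof.
move=> d0; have [|a [c [c' [/andP[a0 a1] wc wc' [az az'] e]]]] := @stein_split w (w + d).
  by rewrite lerDl ltW.
exists a, (a * (c * stein c) + (1 - a) * (c' * stein c')); split.
- by case: (leP (w + d) z) => // /az->.
- by case: (leP w z) => // /az'->.
- rewrite e; ring.
- move=> u wu.
  have near_u t : w <= t <= w + d -> `|t - u| <= d by move=> ?; rewrite ler_norml; lra.
  have := id_stein_lipschitz (near_u _ wc); have := id_stein_lipschitz (near_u _ wc').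
  by rewrite !ler_norml; nra.
Qed.

End SteinSolution.

(** * Sums of independent Bernoulli variables *)

Section BernoulliSum.
Variables (R : realType) (p : nat -> R).
Hypothesis p01 : forall i, 0 <= p i <= 1.
Implicit Types (n k : nat) (F G U : nat -> R).

(* Expectation of F (xi_0 + .. + xi_(n-1)) for independent xi_i of law
   Bernoulli (p i). *)
Fixpoint bern n F : R :=
  if n is n'.+1 then p n' * bern n' (F \o succn) + (1 - p n') * bern n' F
  else F 0%N.

(* The sum over i of p i * (1 - p i) times the expectation of G at the sum
   with xi_i left out. *)
Fixpoint bern_loo n G : R :=
  if n is n'.+1 then
    p n' * (1 - p n') * bern n' G +
    (p n' * bern_loo n' (G \o succn) + (1 - p n') * bern_loo n' G)
  else 0.

Definition bern_mean n : R := \sum_(i < n) p i.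
Definition bern_var n : R := \sum_(i < n) p i * (1 - p i).

Lemma eq_bern n F G : F =1 G -> bern n F = bern n G.
Proof. by move=> /funext->. Qed.

Lemma eq_bern_loo n F G : F =1 G -> bern_loo n F = bern_loo n G.
Proof. by move=> /funext->. Qed.

Lemma bernD n F G : bern n (F \+ G) = bern n F + bern n G.
Proof.
elim: n F G => //= n IH F G; rewrite (@eq_bern _ _ ((F \o succn) \+ (G \o succn)))//.
by rewrite !IH; ring.
Qed.

Lemma bernZ n c F : bern n (fun k => c * F k) = c * bern n F.
Proof.
elim: n F => //= n IH F; rewrite (@eq_bern _ _ (fun k => c * (F \o succn) k))//.
by rewrite !IH; ring.
Qed.

Lemma bern_cst n c : bern n (fun=> c) = c.
Proof.
elim: n => //= n IH; rewrite (@eq_bern _ _ (fun=> c))// IH; ring.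
Qed.

Lemma bernB n F G : bern n (fun k => F k - G k) = bern n F - bern n G.
Proof.
rewrite (@eq_bern _ _ (F \+ (fun k => -1 * G k))) ?bernD ?bernZ ?mulN1r//.
by move=> k /=; rewrite mulN1r.
Qed.

Lemma ler_bern n F G : (forall k, F k <= G k) -> bern n F <= bern n G.
Proof.
elim: n F G => //= n IH F G FG; have /andP[p0 p1] := p01 n.
by rewrite lerD// ler_wpM2l ?subr_ge0// IH// => k; exact: FG.
Qed.

Lemma bern_looZ n c G : bern_loo n (fun k => c * G k) = c * bern_loo n G.
Proof.
elim: n G => [|n IH] G /=; first by rewrite mulr0.
rewrite (@eq_bern_loo _ ((fun k => c * G k) \o succn) (fun k => c * (G \o succn) k))//.
by rewrite !IH bernZ; ring.
Qed.

Lemma bern_var_ge0 n : 0 <= bern_var n.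
Proof.
by apply: sumr_ge0 => i _; have /andP[? ?] := p01 i; rewrite mulr_ge0 ?subr_ge0.
Qed.

(** Restoring the omitted [xi_i] turns the value [k] into [k] or [k.+1]. If [U] dominates [G k] at
    both, each leave-one-out expectation is at most that of [U] at the full sum, whatever [i] is. *)
Lemma bern_loo_le n G U : (forall k, G k <= U k) -> (forall k, G k <= U k.+1) ->
  bern_loo n G <= bern_var n * bern n U.
Proof.
elim: n G U => [|n IH] G U GU GU1 /=; first by rewrite /bern_var big_ord0 mul0r.
have /andP[p0 p1] := p01 n; rewrite -subr_ge0 in p1.
have leB : bern n G <= p n * bern n (U \o succn) + (1 - p n) * bern n U.
  have -> : bern n G = p n * bern n G + (1 - p n) * bern n G by ring.
  by rewrite lerD// ler_wpM2l// ler_bern.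
have leS : bern_loo n (G \o succn) <= bern_var n * bern n (U \o succn).
  by apply: IH => k /=.
have leV := IH _ _ GU GU1; rewrite /bern_var big_ord_recr /= -/(bern_var n).
have := ler_wpM2l (mulr_ge0 p0 p1) leB.
have := ler_wpM2l p0 leS; have := ler_wpM2l p1 leV; nra.
Qed.

Lemma bern_loo_ge n G U : (forall k, U k <= G k) -> (forall k, U k.+1 <= G k) ->
  bern_var n * bern n U <= bern_loo n G.
Proof.
move=> UG UG1; have := @bern_loo_le n (fun k => -1 * G k) (fun k => -1 * U k).
rewrite bern_looZ bernZ => h; have {}h := h _ _.
suff : -1 * bern_loo n G <= bern_var n * (-1 * bern n U) by lra.
by apply: h => k; rewrite !mulN1r lerN2.
Qed.

(** For a single variable, E[(xi - p) h(xi)] = p (1 - p) (h 1 - h 0); this is applied to each [xi_i]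
    with the others held fixed. *)
Lemma bern_stein n g :
  bern n (fun k => (k%:R - bern_mean n) * g k) = bern_loo n (fun k => g k.+1 - g k).
Proof.
elim: n g => [|n IH] g /=; first by rewrite /bern_mean big_ord0 subrr mul0r.
rewrite /bern_mean big_ord_recr /= -/(bern_mean n); set mu := bern_mean n in IH *.
rewrite (@eq_bern_loo _ _ (fun k => (g \o succn) k.+1 - (g \o succn) k))// -!IH.
rewrite (@eq_bern _ (_ \o succn)
  ((fun k => (k%:R - mu) * (g \o succn) k) \+ (fun k => (1 - p n) * (g \o succn) k))).
  rewrite (@eq_bern _ (fun k => (k%:R - (mu + p n)) * g k)
    ((fun k => (k%:R - mu) * g k) \+ (fun k => - p n * g k))).
    by rewrite bernB !bernD !bernZ; ring.
  by move=> k /=; ring.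
by move=> k /=; rewrite -natr1; ring.
Qed.

Lemma bern_loo_cst1 n : bern_loo n (fun=> 1) = bern_var n.
Proof.
elim: n => [|n IH] /=; first by rewrite /bern_var big_ord0.
rewrite bern_cst (@eq_bern_loo _ _ (fun=> 1))// IH /bern_var big_ord_recr /=.
by ring.
Qed.

Lemma bern_center2 n : bern n (fun k => (k%:R - bern_mean n) ^+ 2) = bern_var n.
Proof.
rewrite -bern_loo_cst1 (@eq_bern_loo _ _
  (fun k => (k.+1%:R - bern_mean n) - (k%:R - bern_mean n))) -?bern_stein.
  by apply: eq_bern => k; rewrite expr2.
by move=> k; rewrite -natr1; ring.
Qed.

Lemma bern_id n : bern n (fun k => k%:R) = bern_mean n.
Proof.
have := bern_stein n (fun=> 1); rewrite (@eq_bern_loo _ _ (fun k => 0 * 0)); last first.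
  by move=> k; ring.
rewrite bern_looZ mul0r (@eq_bern _ _ (fun k => k%:R - bern_mean n)); last first.
  by move=> k; rewrite mulr1.
by rewrite bernB bern_cst => /eqP; rewrite subr_eq0 => /eqP.
Qed.

(* With W = (xi_0 + .. + xi_(n-1) - mean) / s, Stein's identity turns E[W f(W)]
   into an average of difference quotients of f = stein z over steps of length
   1/s. By Stein's equation these equal 1_{W <= z} - Phi z + W f(W) up to O(1/s),
   the indicator being caught between its two shifts by 1/s; the terms E[W f(W)]
   cancel and no concentration inequality is needed. *)
Section BerryEsseen.
Variable n : nat.
Hypothesis var_gt0 : 0 < bern_var n.
Let s := Num.sqrt (bern_var n).
Let w k : R := (k%:R - bern_mean n) / s.
Let d := s^-1.

Let s_gt0 : 0 < s. Proof. by rewrite sqrtr_gt0. Qed.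
Let d_gt0 : 0 < d. Proof. by rewrite invr_gt0. Qed.
Let wS k : w k.+1 = w k + d.
Proof. by rewrite /w -natr1 /d mulrDl mulrDl addrAC -!mulrDl; field; rewrite gt_eqF. Qed.

(** In place of Cauchy-Schwarz: E[w^2] = 1 and |w| <= (w^2 + 1) / 2. *)
Let abs_w : bern n (fun k => `|w k|) <= 1.
Proof.
have sq : bern n (fun k => w k ^+ 2) = 1.
  rewrite (@eq_bern _ _ (fun k => (bern_var n)^-1 * (k%:R - bern_mean n) ^+ 2)).
    by rewrite bernZ bern_center2 mulVf// gt_eqF.
  by move=> k; rewrite /w expr_div_n sqr_sqrtr ?bern_var_ge0// mulrC.
have := @ler_bern n (fun k => `|w k|) (fun k => 2^-1 * (w k ^+ 2) - - 2^-1).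
rewrite bernB bernZ bern_cst sq => h; apply: (le_trans (h _)); last by lra.
by move=> k; rewrite -(real_normK (num_real (w k))); have := sqr_ge0 (`|w k| - 1); lra.
Qed.

Local Notation B := (stein_bound R).

Let err_le : bern n (fun k => d * (B + 2 * `|w k|)) <= d * (B + 2).
Proof.
rewrite bernZ ler_wpM2l ?(ltW d_gt0)//.
rewrite (@eq_bern _ _ ((fun=> B) \+ (fun k => 2 * `|w k|)))// bernD bernZ bern_cst.
by have := abs_w; lra.
Qed.

Let stein_id z : bern n (fun k => w k * stein z (w k)) =
  bern_loo n (fun k => stein z (w k + d) - stein z (w k)) / s.
Proof.
rewrite (@eq_bern_loo _ _ (fun k => stein z (w k.+1) - stein z (w k))); last first.
  by move=> k; rewrite wS.
rewrite -bern_stein mulrC -bernZ; apply: eq_bern => k; rewrite /w.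
by rewrite [RHS]mulrA (mulrC s^-1).
Qed.

Let var_s : bern_var n = s * s.
Proof. by rewrite -expr2 sqr_sqrtr// ltW. Qed.

Let shift_lower z : Phi z <= bern n (fun k => (w k <= z + d)%R%:R) + d * (B + 2).
Proof.
(* The bound is needed at [k] and at [k.+1]. The indicator of [w k <= z + d] dominates that of
   [w k <= z], and equals it once [k] is replaced by [k.+1]. *)
pose U k := d * ((w k <= z + d)%R%:R + w k * stein z (w k) - Phi z +
  d * (B + 2 * `|w k|)).
have := @bern_loo_le n (fun k => stein z (w k + d) - stein z (w k)) U.
move=> h; have {}h : bern_loo n (fun k => stein z (w k + d) - stein z (w k)) <=
    bern_var n * bern n U.
  apply: h => k; have [a [e [_ ale -> eu]]] := stein_step z (w k) d_gt0;
    rewrite /U mulrC ler_wpM2l ?(ltW d_gt0)//.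
  - have := eu (w k); rewrite lexx lerDl (ltW d_gt0) => /(_ isT).
    rewrite ler_norml => /andP[_ e1].
    have : (w k <= z)%R%:R <= (w k <= z + d)%R%:R :> R.
      by rewrite ler_nat; case: (leP (w k) z) => // wz; rewrite (le_trans wz)// lerDl ltW.
    by lra.
  - have := eu (w k + d); rewrite lexx lerDl (ltW d_gt0) => /(_ isT).
    rewrite ler_norml => /andP[_ e1]; rewrite wS lerD2r; lra.
have eU : bern n U = d * (bern n (fun k => (w k <= z + d)%R%:R) +
    bern n (fun k => w k * stein z (w k)) - Phi z + bern n (fun k => d * (B + 2 * `|w k|))).
  rewrite (@eq_bern _ U (fun k => d * (((fun k => (w k <= z + d)%R%:R) \+
    (fun k => w k * stein z (w k)) \+ (fun=> - Phi z) \+ (fun k => d * (B + 2 * `|w k|))) k))).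
    by rewrite bernZ !bernD bern_cst.
  by move=> k; rewrite /U/=.
move: h; rewrite eU stein_id var_s; set D := bern_loo _ _.
(* As [bern_var n = s * s] and [d = s^-1], division by [s] leaves [D / s], which is E[w f(w)], on
   both sides, and it cancels. *)
have -> : forall t, s * s * (d * t) = s * t by move=> t; rewrite /d; field; rewrite gt_eqF.
rewrite -ler_pdivrMl// [s^-1 * _]mulrC; have := err_le; lra.
Qed.

Let shift_upper z : bern n (fun k => (w k + d <= z)%R%:R) <= Phi z + d * (B + 2).
Proof.
pose U k := d * ((w k + d <= z)%R%:R + w k * stein z (w k) - Phi z -
  d * (B + 2 * `|w k|)).
have := @bern_loo_ge n (fun k => stein z (w k + d) - stein z (w k)) U.
move=> h; have {}h : bern_var n * bern n U <=
    bern_loo n (fun k => stein z (w k + d) - stein z (w k)).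
  apply: h => k; have [a [e [ale _ -> eu]]] := stein_step z (w k) d_gt0;
    rewrite /U [leRHS]mulrC ler_wpM2l ?(ltW d_gt0)//.
  - have := eu (w k); rewrite lexx lerDl (ltW d_gt0) => /(_ isT).
    rewrite ler_norml => /andP[e1 _]; lra.
  - have := eu (w k + d); rewrite lexx lerDl (ltW d_gt0) => /(_ isT).
    rewrite ler_norml => /andP[e1 _]; rewrite wS.
    have : (w k + d + d <= z)%R%:R <= (w k + d <= z)%R%:R :> R.
      rewrite ler_nat; case: (leP (w k + d + d) z) => // wz.
      by rewrite (le_trans _ wz)// lerDl ltW.
    by lra.
have eU : bern n U = d * (bern n (fun k => (w k + d <= z)%R%:R) +
    bern n (fun k => w k * stein z (w k)) - Phi z - bern n (fun k => d * (B + 2 * `|w k|))).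
  rewrite (@eq_bern _ U (fun k => d * (((fun k => (w k + d <= z)%R%:R) \+
    (fun k => w k * stein z (w k)) \+ (fun=> - Phi z) \+ (fun k => -1 * (d * (B + 2 * `|w k|)))) k))).
    by rewrite bernZ !bernD bernZ mulN1r bern_cst.
  by move=> k; rewrite /U/= mulN1r.
move: h; rewrite eU stein_id var_s; set D := bern_loo _ _.
have -> : forall t, s * s * (d * t) = s * t by move=> t; rewrite /d; field; rewrite gt_eqF.
rewrite -ler_pdivlMl// [s^-1 * _]mulrC; have := err_le; lra.
Qed.

Lemma bern_berry_esseen x :
  `|bern n (fun k => ((k%:R - bern_mean n) / s <= x)%R%:R) - Phi x|
    <= (stein_bound R + 3) / s.
Proof.
(* The thresholds are moved by [d] to undo the displacement of the indicators; the Lipschitz bound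
   on [Phi] then costs one more [d], whence [stein_bound R + 3]. *)
have lo := shift_lower (x - d); have up := shift_upper (x + d).
have l1 := @Phi_lipschitz R (x - d) x; have l2 := @Phi_lipschitz R x (x + d).
move: lo up l1 l2; rewrite subrK gerBl lerDl (ltW d_gt0).
rewrite (@eq_bern _ (fun k => (w k + d <= x + d)%R%:R) (fun k => (w k <= x)%R%:R)); last first.
  by move=> k; rewrite lerD2r.
move=> lo up /(_ isT) l1 /(_ isT) l2; rewrite -/d ler_norml -/(w _).
by move: lo up l1 l2; rewrite /w => *; nra.
Qed.

End BerryEsseen.
End BernoulliSum.

(** * Right-to-left maxima and Pareto-undominated columns *)

Section Records.
Variable R : realType.

Definition rl_max n (s : 'S_n) (a : 'I_n) : bool :=
  [forall b : 'I_n, (a < b)%N ==> (s b < s a)%N].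

Definition num_rl_max n (s : 'S_n) : nat := \sum_(a < n) rl_max s a.

Lemma lift_perm_bij n :
  bijective (fun u : 'I_n.+1 * 'S_n => lift_perm ord0 u.1 u.2).
Proof.
apply: inj_card_bij => [[i s] [j t] /= e|]; last first.
  by rewrite card_prod card_ord !card_Sn factS.
have ij : i = j by rewrite -(lift_perm_id ord0 i s) e lift_perm_id.
rewrite -ij in e *; congr (_, _); apply/permP => k.
by apply: (@lift_inj _ i); rewrite -(lift_perm_lift ord0) e lift_perm_lift.
Qed.

Lemma rl_max_lift_perm0 n (i : 'I_n.+1) (s : 'S_n) :
  rl_max (lift_perm ord0 i s) ord0 = (i == ord_max).
Proof.
apply/forallP/eqP => [all_lt|-> b]; last first.
  apply/implyP; case: (unliftP ord0 b) => [b'|] -> //= _.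
  rewrite lift_perm_lift lift_perm_id lift_max /=; exact: ltn_ord.
apply/eqP; apply: contraT => neq; have := all_lt ((lift_perm ord0 i s)^-1%g ord_max).
have max_lt : ((ord_max : 'I_n.+1) < i)%N = false.
  by apply/negbTE; rewrite -leqNgt -ltnS ltn_ord.
rewrite permKV lift_perm_id max_lt implybF.
rewrite -eqn0Ngt => /eqP e0.
have pre0 : (lift_perm ord0 i s)^-1%g ord_max = ord0 by apply: ord_inj.
have := permKV (lift_perm ord0 i s) ord_max; rewrite pre0 lift_perm_id => max_i.
by move: neq; rewrite max_i eqxx.
Qed.

Lemma rl_max_lift_permS n (i : 'I_n.+1) (s : 'S_n) (a : 'I_n) :
  rl_max (lift_perm ord0 i s) (lift ord0 a) = rl_max s a.
Proof.
have lift_ltn (x y : 'I_n) : (lift i x < lift i y)%N = (x < y)%N.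
  by rewrite !ltnNge leq_bump2.
apply/forallP/forallP => all_lt b.
  by have := all_lt (lift ord0 b); rewrite !lift_perm_lift lift_ltn.
case: (unliftP ord0 b) => [b'|] -> //.
by rewrite !lift_perm_lift lift_ltn; exact: all_lt.
Qed.

(* The first entry of a uniform permutation is uniform and independent of the
   relative order of the others, and it is a right-to-left maximum iff it is
   the largest. *)
Lemma num_rl_max_lift_perm n (i : 'I_n.+1) (s : 'S_n) :
  num_rl_max (lift_perm ord0 i s) = ((i == ord_max) + num_rl_max s)%N.
Proof.
rewrite /num_rl_max big_ord_recl rl_max_lift_perm0; congr addn.
by apply: eq_bigr => a _; rewrite rl_max_lift_permS.
Qed.

Lemma sum_num_rl_max n (h : nat -> R) :
  \sum_(s : 'S_n) h (num_rl_max s) = n`!%:R * bern harmonic n h.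
Proof.
elim: n h => [|n IH] h.
  rewrite fact0 mul1r /= (eq_bigr (fun=> h 0%N)) => [|s _].
    by rewrite sumr_const cardT -cardE card_Sn.
  by rewrite /num_rl_max big_ord0.
rewrite (reindex _ (onW_bij _ (lift_perm_bij n)))/=.
rewrite -(pair_big predT predT (fun i s => h (num_rl_max (lift_perm ord0 i s))))/=.
under eq_bigr do under eq_bigr do rewrite num_rl_max_lift_perm.
(* Only [i = ord_max], one value in [n.+1], adds a record; its weight is [harmonic n], which is 1 /
   (n + 1) because [harmonic] is indexed from 0. *)
rewrite big_ord_recr /= eqxx (IH (h \o succn)).
rewrite (eq_bigr (fun=> n`!%:R * bern harmonic n h)) => [|i _]; last first.
  rewrite -IH; apply: eq_bigr => s _.
  by rewrite -val_eqE /= ltn_eqF.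
rewrite sumr_const card_ord -mulr_natl factS natrM.
have n0 : n.+1%:R != 0 :> R by rewrite pnatr_eq0.
by rewrite -natr1 in n0 *; field.
Qed.

Definition pareto n (t : {ffun 'I_2 -> 'S_n}) (j : 'I_n) : bool :=
  ~~ [exists j' : 'I_n, [forall y : 'I_2, (t y j < t y j')%N]].

Lemma forall_I2 (Q : pred 'I_2) : [forall y, Q y] = Q ord0 && Q ord_max.
Proof.
apply/forallP/andP => [Qy|[Q0 Q1] y]; first by split.
by case: y => [[|[|//]] i]; [rewrite (_ : Ordinal i = ord0) | rewrite (_ : Ordinal i = ord_max)] => //;
  apply: val_inj.
Qed.

Lemma sum_ffun_I2 (T : finType) (F : T -> T -> R) :
  \sum_(t : {ffun 'I_2 -> T}) F (t ord0) (t ord_max) = \sum_a \sum_b F a b.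
Proof.
pose f (u : T * T) : {ffun 'I_2 -> T} := [ffun y => if y == ord0 then u.1 else u.2].
rewrite (reindex f) /=; last first.
  apply: onW_bij; exists (fun t : {ffun 'I_2 -> T} => (t ord0, t ord_max)).
    by case=> a b; rewrite /f !ffunE.
  move=> t; apply/ffunP => y; rewrite /f ffunE /=.
  by case: eqP => [->//|/eqP]; case: y => [[|[|//]] i] //= _; congr (t _); apply: val_inj.
rewrite pair_big /=; apply: eq_bigr => u _; by rewrite /f !ffunE.
Qed.

(** Place column [j] at position [t ord0 j], its rank in the first row. A column dominating [j] then
    stands further right and has a larger payoff in the second row, so being undominated means being
    a right-to-left maximum. *)
Lemma card_pareto n (t : {ffun 'I_2 -> 'S_n}) :
  #|[set j | pareto t j]%SET| = num_rl_max ((t ord0)^-1 * t ord_max)%g.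
Proof.
rewrite -sum1dep_card /num_rl_max [RHS](reindex_inj (@perm_inj _ (t ord0))) /=.
rewrite big_mkcond; apply: eq_bigr => j _ /=.
suff -> : pareto t j = rl_max ((t ord0)^-1 * t ord_max)%g (t ord0 j) by case: rl_max.
rewrite /pareto negb_exists; apply/forallP/forallP => H b.
  have := H ((t ord0)^-1%g b); rewrite forall_I2 permKV !permM permK.
  case: ltnP => //= ab; rewrite -leqNgt leq_eqVlt => /orP[/eqP/val_inj/perm_inj e|//].
  by move: ab; rewrite -e permKV ltnn.
have := H (t ord0 b); rewrite forall_I2 !permM !permK.
by case: ltnP => //= _; rewrite -leqNgt => /ltnW.
Qed.

(** For each fixed [a], the quotient [a^-1 * b] runs once through ['S_n] as [b] does, so the
    relative permutation is uniform. *)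
Lemma sum_pareto n (h : nat -> R) :
  \sum_(t : {ffun 'I_2 -> 'S_n}) h #|[set j | pareto t j]%SET| =
  n`!%:R * n`!%:R * bern harmonic n h.
Proof.
under eq_bigr do rewrite card_pareto.
rewrite (sum_ffun_I2 (fun a b => h (num_rl_max (a^-1 * b)%g))).
rewrite (eq_bigr (fun=> n`!%:R * bern harmonic n h)) => [|a _].
  by rewrite sumr_const cardT -cardE card_Sn -[LHS]mulr_natl mulrA.
rewrite (reindex_inj (mulgI a)) /= -sum_num_rl_max.
by apply: eq_bigr => b _; rewrite mulKg.
Qed.

Lemma pareto_gt0 n (t : {ffun 'I_2 -> 'S_n}) : (0 < n)%N ->
  (0 < #|[set j | pareto t j]%SET|)%N.
Proof.
case: n t => // n t _; apply/card_gt0P; exists ((t ord0)^-1%g ord_max).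
rewrite inE /pareto negb_exists; apply/forallP => j.
by rewrite forall_I2 permKV negb_and -leqNgt -ltnS ltn_ord.
Qed.

End Records.

(** * The columns surviving elimination *)

Section SurvivingColumns.

Lemma exists_I2 (Q : pred 'I_2) : [exists y, Q y] = Q ord0 || Q ord_max.
Proof.
by apply: negb_inj; rewrite negb_exists forall_I2 negb_or.
Qed.

(** A best reply to any one remaining action of the opponent is never strictly dominated. *)
Lemma elim_round_neq0 m n (r c : 'M[nat]_(m, n)) s :
  s.1 != finset.set0 -> s.2 != finset.set0 ->
  (elim_round r c s).1 != finset.set0 /\ (elim_round r c s).2 != finset.set0.
Proof.
case: s => Y X /= /set0Pn[y Yy] /set0Pn[x Xx]; split; apply/set0Pn.
- case: (@arg_maxnP _ y (fun i => i \in Y) (fun i => r i x) Yy) => i Yi maxi.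
  exists i; rewrite inE /= Yi /=; apply/existsP => -[i' /andP[Yi' /forallP/(_ x)]].
  by rewrite Xx /= ltnNge (maxi _ Yi' : (r i' x <= r i x)%N).
- case: (@arg_maxnP _ x (fun j => j \in X) (fun j => c y j) Xx) => j Xj maxj.
  exists j; rewrite inE /= Xj /=; apply/existsP => -[j' /andP[Xj' /forallP/(_ y)]].
  by rewrite Yy /= ltnNge (maxj _ Xj' : (c y j' <= c y j)%N).
Qed.

Lemma elim_round_sub2 m n (r c : 'M[nat]_(m, n)) s :
  (elim_round r c s).2 \subset s.2.
Proof. by apply/fintype.subsetP => i; rewrite inE => /andP[]. Qed.

Variables (n : nat) (g : game 2 n).
Hypothesis n_gt0 : (0 < n)%N.
Let r := row_payoffs g.
Let c := col_payoffs g.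
Let undominated := [set j | pareto g.2 j]%SET.

Definition row_beaten (X : {set 'I_n}) (i i' : 'I_2) : bool :=
  [forall x in X, (g.1 x i < g.1 x i')%N].

Lemma row_dominatedE (Y : {set 'I_2}) X i :
  row_dominated r Y X i = [exists i' in Y, row_beaten X i i'].
Proof.
apply: eq_existsb => i'; congr andb.
by apply: eq_forallb => x; rewrite !mxE ltnS.
Qed.

Lemma row_beaten_irrefl X i : X != finset.set0 -> row_beaten X i i = false.
Proof.
by case/set0Pn => x Xx; apply/negbTE/negP => /forallP/(_ x); rewrite Xx ltnn.
Qed.

Lemma col_dominated_first j :
  col_dominated c [set: 'I_2] [set: 'I_n] j = ~~ (j \in undominated).
Proof.
rewrite inE negbK; apply: eq_existsb => j'; rewrite inE.
by apply: eq_forallb => y; rewrite !mxE inE ltnS.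
Qed.

Lemma undominated_neq0 : undominated != finset.set0.
Proof. by rewrite -card_gt0 pareto_gt0. Qed.

Lemma elim_first : (elim_round r c ([set: 'I_2], [set: 'I_n])%SET).2 = undominated.
Proof. by apply/setP => j; rewrite inE /= inE col_dominated_first negbK. Qed.

Definition rows_agree : bool :=
  row_beaten undominated ord0 ord_max || row_beaten undominated ord_max ord0.

Lemma row_dominated_undominated i :
  row_dominated r [set: 'I_2] undominated i -> rows_agree.
Proof.
rewrite row_dominatedE exists_I2 !inE /= /rows_agree.
case: i => [[|[|//]] i2].
  rewrite (_ : Ordinal i2 = ord0); last exact: val_inj.
  by rewrite row_beaten_irrefl ?undominated_neq0//= => ->.
rewrite (_ : Ordinal i2 = ord_max); last exact: val_inj.
by rewrite (@row_beaten_irrefl _ ord_max) ?undominated_neq0// orbF => ->; rewrite orbT.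
Qed.

(** The state is fixed after one round. A row beaten on all columns would be beaten on
    [undominated], so both rows stay; and with both rows present, a column dominated within
    [undominated] would have been dominated at the start. *)
Lemma surviving_disagree : ~~ rows_agree -> (surviving r c).2 = undominated.
Proof.
move=> dis; pose s1 := ([set: 'I_2], undominated)%SET.
have undom i : ~~ row_dominated r [set: 'I_2]%SET undominated i.
  by apply: contra dis; exact: row_dominated_undominated.
have undom0 i : ~~ row_dominated r [set: 'I_2]%SET [set: 'I_n]%SET i.
  apply: contra (undom i) => /existsP[i' /andP[Yi' /forallP all_lt]].
  by apply/existsP; exists i'; rewrite Yi'; apply/forallP => x; apply/implyP => _;
    have := all_lt x; rewrite inE.
have e1 : elim_round r c ([set: 'I_2], [set: 'I_n])%SET = s1.
  rewrite [LHS]surjective_pairing elim_first; congr pair.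
  by apply/setP => i; rewrite !inE undom0.
have e2 : elim_round r c s1 = s1.
  rewrite /elim_round /s1 /=; congr pair; apply/setP => j; rewrite ?inE ?undom//.
  have [jP|//] /= := boolP (pareto g.2 j).
  move: jP; apply: contra => /existsP[j' /andP[_ /forallP all_lt]].
  apply/existsP; exists j'; apply/forallP => y.
  by have := all_lt y; rewrite !mxE inE ltnS.
have fixk k : iter k (elim_round r c) s1 = s1 by elim: k => //= k ->.
by rewrite /surviving addSn iterSr e1 fixk.
Qed.

(** Row's beaten action may leave in the first or the second round, so the rounds are not traced:
    only a non-empty fixed point with columns inside [undominated] is used. Of two remaining rows
    one would be beaten; against a single row [y] the payoffs [g.2 y] are distinct, so all columns
    but the best are dominated. *)
Lemma surviving_agree : rows_agree -> #|(surviving r c).2| = 1%N.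
Proof.
move=> agree; have fixs := elim_round_surviving r c.
have [ne sub] : ((surviving r c).1 != finset.set0 /\ (surviving r c).2 != finset.set0)
    /\ (surviving r c).2 \subset undominated.
  rewrite /surviving addSn iterSr -elim_first.
  have T2 : [set: 'I_2]%SET != finset.set0 by apply/set0Pn; exists ord0; rewrite inE.
  have Tn : [set: 'I_n]%SET != finset.set0.
    by apply/set0Pn; exists (Ordinal n_gt0); rewrite inE.
  move: (@elim_round_neq0 _ _ r c ([set: 'I_2], [set: 'I_n])%SET T2 Tn).
  move: (elim_round _ _ _) => s ne0; elim: (1 + n)%N => //= k [[ne1 ne2] subk].
  by split; [exact: elim_round_neq0 | exact: fintype.subset_trans (elim_round_sub2 _ _ _) subk].
move: fixs ne sub; case: (surviving r c) => Y X /= [] fixY fixX [Y0 X0] XU.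
have {}fixY i : i \in Y -> ~~ row_dominated r Y X i.
  by rewrite -{1}fixY inE => /andP[].
have {}fixX j : j \in X -> ~~ col_dominated c Y X j.
  by rewrite -{1}fixX inE => /andP[].
have beaten i i' : row_beaten undominated i i' -> row_beaten X i i'.
  move=> /forallP bU; apply/forallP => x; apply/implyP => Xx.
  by have := bU x; rewrite (fintype.subsetP XU _ Xx).
have [y Yy] : exists y, Y = [set y]%SET.
  have undom i i' : i \in Y -> i' \in Y -> row_beaten X i i' = false.
    move=> Yi Yi'; apply: contraNF (fixY _ Yi) => b.
    by rewrite row_dominatedE; apply/existsP; exists i'; rewrite Yi'.
  have nfull : ~~ ((ord0 \in Y) && (ord_max \in Y)).
    apply/negP => /andP[Y_0 Y_1]; case/orP: agree => /beaten.
      by rewrite undom.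
    by rewrite undom.
  apply/cards1P; rewrite eqn_leq card_gt0 Y0 andbT leqNgt.
  apply: contra nfull => cY; have /eqP-> : Y == [set: 'I_2]%SET.
    by rewrite eqEcard finset.subsetT cardsT card_ord.
  by rewrite !inE.
apply/eqP; rewrite eqn_leq card_gt0 X0 andbT.
apply/card_le1_eqP => a b Xa Xb; apply/eqP; apply: contraT => ab.
have nlt j j' : j \in X -> j' \in X -> (g.2 y j < g.2 y j')%N = false.
  move=> Xj Xj'; apply: contraNF (fixX _ Xj) => lt.
  apply/existsP; exists j'; rewrite Xj'; apply/forallP => y'; rewrite Yy inE.
  by apply/implyP => /eqP->; rewrite !mxE ltnS.
have e : g.2 y a = g.2 y b.
  apply/ord_inj; have := nlt a b Xa Xb; have := nlt b a Xb Xa.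
  by case: ltngtP.
by rewrite (perm_inj e) eqxx in ab.
Qed.

Lemma card_surviving :
  #|(surviving r c).2| = if rows_agree then 1%N else #|undominated|.
Proof.
by case: ifPn => [/surviving_agree|/surviving_disagree->].
Qed.

End SurvivingColumns.

(** * Counting the games in which Row ranks her actions uniformly *)

Section GameSum.
Variable R : realType.

Lemma card_perm2_lt (i i' : 'I_2) : i != i' ->
  #|[pred p : 'S_2 | (p i < p i')%N]| = 1%N.
Proof.
move=> ii'; pose A (i i' : 'I_2) := [set p : 'S_2 | (p i < p i')%N]%SET.
have swap : #|A i i'| = #|A i' i|.
  rewrite -(card_imset (A i i') (@mulgI _ (tperm i i'))); congr #|pred_of_set _|.
  apply/setP => p; apply/imsetP/idP => [[q + ->]|].
    by rewrite !inE !permM tpermL tpermR.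
  rewrite inE => lt; exists (tperm i i' * p)%g; last by rewrite mulgA tperm2 mul1g.
  by rewrite inE !permM tpermL tpermR.
have disj : A i' i = ~: A i i'.
  apply/setP => p; rewrite !inE -leqNgt [RHS]leq_eqVlt.
  by case: eqP => [/ord_inj/perm_inj e|//]; rewrite e eqxx in ii'.
have := cardsC (A i i'); rewrite -disj -swap card_Sn => /eqP.
by rewrite cardsE addnn => /eqP /(congr1 half); rewrite doubleK.
Qed.

(** The condition acts column by column: one of the two permutations is allowed on [X], both
    elsewhere. *)
Lemma card_row_beaten n (X : {set 'I_n}) (i i' : 'I_2) : i != i' ->
  #|[pred s : {ffun 'I_n -> 'S_2} | [forall x in X, (s x i < s x i')%N]]|
    = (2 ^ (n - #|X|))%N.
Proof.
move=> ii'; pose F (x : 'I_n) : pred 'S_2 := fun p => (x \in X) ==> (p i < p i')%N.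
rewrite (eq_card (B := family F)); last first.
  by move=> s; rewrite !inE; apply: eq_forallb => x; rewrite /F unfold_in.
rewrite card_family foldrE big_image /= (bigID (mem X)) /= big1 ?mul1n; last first.
  by move=> x Xx; apply: etrans (card_perm2_lt ii'); apply: eq_card => p; rewrite !inE /F Xx.
rewrite (eq_bigr (fun=> 2%N)) => [|x /negbTE Xx]; last first.
  by apply: etrans (card_Sn 2); apply: eq_card => p; rewrite /F unfold_in Xx.
rewrite prod_nat_const; congr expn.
have cX : (#|X| + #|[predC X]| = n)%N by rewrite cardC card_ord.
by rewrite -[X in (X - _)%N]cX addKn; apply: eq_card.
Qed.

Lemma card_rows_agree n (t : {ffun 'I_2 -> 'S_n}) (k := #|[set j | pareto t j]%SET|) :
  (0 < n)%N ->
  #|[pred s : {ffun 'I_n -> 'S_2} | rows_agree (s, t)]| = (2 * 2 ^ (n - k))%N.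
Proof.
move=> n0; set X := [set j | pareto t j]%SET in k *.
rewrite (eq_card (B := [predU [pred s : {ffun 'I_n -> 'S_2} |
    [forall x in X, (s x ord0 < s x ord_max)%N]] & [pred s : {ffun 'I_n -> 'S_2} |
    [forall x in X, (s x ord_max < s x ord0)%N]]])); last by move=> s; rewrite !inE.
rewrite -[LHS]addn0 -[X in (_ + X)%N](@eq_card0 _ [predI [pred s : {ffun 'I_n -> 'S_2} |
    [forall x in X, (s x ord0 < s x ord_max)%N]] & [pred s : {ffun 'I_n -> 'S_2} |
    [forall x in X, (s x ord_max < s x ord0)%N]]]).
  by rewrite cardUI !card_row_beaten// addnn mul2n.
move=> s; rewrite !inE; apply/negbTE/negP => /andP[/forallP b0 /forallP b1].
have /card_gt0P[x Xx] := pareto_gt0 t n0.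
by have := b0 x; have := b1 x; rewrite Xx /= => lt /ltnW; rewrite leqNgt lt.
Qed.

Definition agree_prob (k : nat) : R := 2 / 2 ^+ k.

Lemma sum_game n (h : nat -> R) : (0 < n)%N ->
  \sum_(g : game 2 n) h #|(surviving (row_payoffs g) (col_payoffs g)).2| =
  #|{: game 2 n}|%:R *
    bern harmonic n (fun k => (1 - agree_prob k) * h k + agree_prob k * h 1%N).
Proof.
move=> n0; under eq_bigr do rewrite card_surviving//.
rewrite -(pair_bigA _ (fun s t => h (if rows_agree (s, t) then 1%N
  else #|[set j | pareto t j]%SET|)))/= exchange_big /=.
rewrite card_prod !card_ffun !card_ord !card_Sn.
have -> : (2`! ^ n * n`! ^ 2)%:R = (2 ^ n)%:R * (n`!%:R * n`!%:R) :> R.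
  by rewrite -[X in _ = _ * X]natrM mulnn [LHS]natrM.
rewrite -mulrA -sum_pareto mulr_sumr; apply: eq_bigr => t _.
set k := #|[set j | pareto t j]%SET|.
have kn : (k <= n)%N by rewrite -[leqRHS](card_ord n) max_card.
rewrite (bigID (fun s => rows_agree (s, t))) /=.
rewrite (eq_bigr (fun=> h 1%N)) => [|s ->//].
rewrite [X in _ + X](eq_bigr (fun=> h k)) => [|s /negbTE->//].
rewrite !sumr_const (@card_rows_agree n t n0) -/k.
have -> : #|(fun s : {ffun 'I_n -> 'S_2} => ~~ rows_agree (s, t))| =
    (2 ^ n - 2 * 2 ^ (n - k))%N.
  rewrite -(@card_rows_agree n t n0) -[X in (X ^ n)%N]/(2`!) -card_Sn -[X in (_ ^ X)%N](card_ord n).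
  by rewrite -card_ffun -(cardC [pred s | rows_agree (s, t)]) addKn.
(* Positivity of [k] keeps [2 * 2 ^ (n - k)] below [2 ^ n], so the subtraction of naturals is not
   truncated. *)
have k0 : (0 < k)%N by exact: pareto_gt0.
have le : (2 * 2 ^ (n - k) <= 2 ^ n)%N by rewrite -expnS leq_exp2l//; lia.
rewrite -[in LHS]mulr_natl -[X in _ + X]mulr_natl natrB// natrM !natrX.
have -> : 2 ^+ n = 2 ^+ k * 2 ^+ (n - k) :> R by rewrite -exprD subnKC.
have k2 : 2 ^+ k != 0 :> R by rewrite expf_neq0// pnatr_eq0.
by rewrite /agree_prob; field.
Qed.

End GameSum.

(** * Expectations over the game as expectations over [K] *)

Section GameExpectation.
Variable R : realType.

Lemma random_game_set1 m n (g : game m n) :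
  random_game R m n [set g] = (#|{: game m n}|%:R^-1)%:E.
Proof.
rewrite [LHS]/(game_law _ _) /game_law (eq_card (B := pred1 g)) ?card1 ?mul1r//.
by move=> h; rewrite !inE; apply/idP/eqP; rewrite inE.
Qed.

Lemma expectation_game m n (X : game m n -> R) : (forall g, 0 <= X g) ->
  fine 'E_(random_game R m n)[X] = (\sum_g X g) / #|{: game m n}|%:R.
Proof.
move=> X0; rewrite unlock.
transitivity (fine (\int[random_game R m n]_g
    \sum_(h : game m n) ((X h)%:E * (\1_[set h] g)%:E))%E).
  congr fine; apply: eq_integral => g _.
  rewrite (bigD1 g)//= indicE mem_set// mule1 big1 ?adde0// => h hg.
  by rewrite indicE memNset ?mule0//= => e; rewrite e eqxx in hg.
rewrite ge0_integral_sum//; last by move=> h g _; rewrite mule_ge0 ?lee_fin.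
transitivity (fine (\sum_(h : game m n) (X h / #|{: game m n}|%:R)%:E)%E).
  congr fine; apply: eq_bigr => h _.
  rewrite ge0_integralZl_EFin ?X0//.
  rewrite integral_indic// setIT.
  by rewrite EFinM; congr (_ * _)%E; exact: random_game_set1.
by rewrite sumEFin /= mulr_suml.
Qed.

(* Conditional expectation of h (S^C) given that k columns survive the first
   round: with probability 2^(1-k) Row ranks her two actions the same way in
   all these columns, and then a single column survives. The case k = 0, where
   agree_prob is not a probability, has mass 0 since harmonic 0 = 1. *)
Definition surv (h : nat -> R) (k : nat) : R :=
  (1 - agree_prob R k) * h k + agree_prob R k * h 1%N.

Lemma expectation_surviving n (h : nat -> R) : (0 < n)%N -> (forall k, 0 <= h k) ->
  fine 'E_(random_game R 2 n)[fun g => h #|(surviving (row_payoffs g) (col_payoffs g)).2|]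
    = bern harmonic n (surv h).
Proof.
move=> n0 h0; rewrite expectation_game// sum_game// mulrC mulKf//.
by rewrite pnatr_eq0 -lt0n card_game_gt0.
Qed.

Lemma mean_SCE n : (0 < n)%N ->
  mean_SC R 2 n = bern harmonic n (surv (fun k => k%:R)).
Proof. by move=> n0; rewrite -expectation_surviving. Qed.

Lemma var_SCE n : (0 < n)%N ->
  var_SC R 2 n = bern harmonic n (surv (fun k => (k%:R - mean_SC R 2 n) ^+ 2)).
Proof.
move=> n0; rewrite -expectation_surviving//; last by move=> k; exact: sqr_ge0.
rewrite /var_SC /variance [in LHS]unlock; congr (fine _).
Qed.

Lemma prob_SCE n (P : pred R) : (0 < n)%N ->
  fine (random_game R 2 n [set g | P (SC R g)]) =
  bern harmonic n (surv (fun k => (P k%:R)%:R)).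
Proof.
move=> n0; rewrite -expectation_surviving// expectation_game//.
rewrite /random_game/= /game_law /= -sum1_card natr_sum big_mkcond /=.
congr (_ / _); apply: eq_bigr => g _; rewrite inE -[in RHS]/(SC R g).
by rewrite mem_setE unfold_in; case: (P _).
Qed.

End GameExpectation.

(** * Euler's constant and the Basel sum *)

Section EulerMascheroni.
Variable R : realType.
Implicit Type n : nat.

Lemma bern_mean_harmonic n : bern_mean harmonic n = series harmonic n :> R.
Proof. by rewrite /bern_mean /series /= big_mkord. Qed.

Lemma series_harmonicS n : series harmonic n.+1 = series harmonic n + n.+1%:R^-1 :> R.
Proof. by rewrite /series /= big_nat_recr. Qed.

Lemma ln_succ_le_harmonic n : ln n.+1%:R <= series harmonic n :> R.
Proof.
elim: n => [|n IH]; first by rewrite ln1 /series /= big_nil.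
rewrite series_harmonicS.
have -> : n.+2%:R = n.+1%:R * (1 + n.+1%:R^-1) :> R.
  by rewrite mulrDr mulr1 divff ?pnatr_eq0// natr1.
have i0 : 0 < n.+1%:R^-1 :> R by rewrite invr_gt0.
rewrite lnM ?posrE ?addr_gt0//; apply: lerD; first exact: IH.
by apply: le_ln1Dx; apply: lt_trans i0; rewrite ltrN10.
Qed.

Lemma ln_le_harmonic n : ln n%:R <= series harmonic n :> R.
Proof.
apply: le_trans (ln_succ_le_harmonic n); case: n => [|n].
  by rewrite ln0// ln1.
by rewrite ler_ln ?posrE// ler_nat.
Qed.

Lemma harmonic_sub_ln_decr n : (0 < n)%N ->
  series harmonic n.+1 - ln n.+1%:R <= series harmonic n - ln n%:R :> R.
Proof.
move=> n0; rewrite series_harmonicS.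
have nn : 0 < n%:R :> R by rewrite ltr0n.
have e : n%:R = n.+1%:R * (1 + - n.+1%:R^-1) :> R.
  by rewrite mulrDr mulr1 mulrN divff ?pnatr_eq0// -natr1 addrK.
have i1 : n.+1%:R^-1 < 1 :> R by rewrite invf_lt1 ?ltr0n// ltr1n.
have lnE : ln n%:R = ln n.+1%:R + ln (1 + - n.+1%:R^-1) :> R.
  by rewrite {1}e lnM ?posrE ?subr_gt0.
have := @le_ln1Dx R (- n.+1%:R^-1); rewrite ltrN2 => /(_ i1) lnle.
rewrite lnE opprD addrA [leRHS]addrAC lerD2r lerD2l lerNr.
exact: lnle.
Qed.

Lemma cvg_euler_mascheroni :
  (series harmonic n - ln n%:R : R) @[n --> \oo] --> euler_mascheroni R.
Proof.
pose u (n : nat) : R := series harmonic n - ln n%:R.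
(* The sequence decreases only from index 1 on: the convention [ln 0 = 0] gives [u 0 = 0] while
   [u 1 = 1]. *)
suff : cvgn (fun n => u n.+1).
  by case/cvg_ex => l; rewrite (cvg_shiftS u) => ul; apply/cvg_ex; exists l.
apply: nonincreasing_is_cvgn.
  by apply/nonincreasing_seqP => n; exact: harmonic_sub_ln_decr.
exists 0 => _ [n _ <-]; by rewrite subr_ge0 ln_le_harmonic.
Qed.

End EulerMascheroni.

Section Basel.
Variable R : realType.
Implicit Types (x y : R) (N n : nat).

Lemma sin_le x : 0 <= x -> sin x <= x.
Proof.
move=> x0; have [c _] := @mvt_le R sin cos 0 x x0 (fun t _ => is_derive_sin t).
rewrite sin0 !subr0 => ->; rewrite ler_piMl// cos_le1.
Qed.

Lemma mul_cos_le_sin x : 0 <= x < pi / 2 -> x * cos x <= sin x.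
Proof.
move=> /andP[x0 xpi].
have cos0 c : 0 <= c <= x -> 0 < cos c.
  by move=> /andP[c0 cx]; apply: cos_gt0_pihalf; have := pi_gt0 R; lra.
have [|c c0x] := @mvt_le R tan (fun t => (cos t) ^- 2) 0 x x0.
  by move=> c /cos0 c0; apply: is_derive_tan; rewrite gt_eqF.
rewrite tan0 !subr0 => e; have cx := cos0 x; rewrite x0 lexx in cx.
have {}cx := cx isT; rewrite -ler_pdivlMr// -/(tan x) e ler_peMl//.
have cc := cos0 _ c0x; rewrite -exprVn exprn_ege1// invf_ge1// cos_le1//.
Qed.

(** The lower bound is cot^2 x; both sides come from [x * cos x <= sin x <= x]. *)
Lemma inv_sqr_bounds x : 0 < x < pi / 2 ->
  (sin x ^+ 2)^-1 - 1 <= (x ^+ 2)^-1 <= (sin x ^+ 2)^-1.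
Proof.
move=> /andP[x0 xpi]; have s0 : 0 < sin x by apply: sin_gt0_pihalf; rewrite x0.
have c0 : 0 < cos x by apply: cos_gt0_pihalf; have := pi_gt0 R; lra.
have sx := sin_le (ltW x0); have xc := @mul_cos_le_sin x; rewrite (ltW x0) xpi in xc.
have {}xc := xc isT; apply/andP; split; last first.
  by rewrite lef_pV2 ?posrE ?exprn_gt0// lerXn2r// nnegrE ltW.
have -> : (sin x ^+ 2)^-1 - 1 = cos x ^+ 2 / sin x ^+ 2.
  by rewrite cos2sin2; field; rewrite gt_eqF.
rewrite ler_pdivrMr ?exprn_gt0// mulrC ler_pdivlMr ?exprn_gt0// mulrC -exprMn.
by rewrite lerXn2r// nnegrE ltW// mulr_gt0.
Qed.

(** These are the odd multiples of pi / (4 N) in (0, pi / 2). Their inverse squares sum to 16 N^2 /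
    pi^2 times a partial sum over the odd squares. *)
Definition odd_angle N (j : nat) : R := (2 * j%:R + 1) * pi / (4 * N%:R).

Lemma odd_angle_itv N j : (j < N)%N -> 0 < odd_angle N j < pi / 2.
Proof.
move=> jN; have N0 : 0 < N%:R :> R by rewrite ltr0n (leq_ltn_trans _ jN).
have j1 : j%:R + 1 <= N%:R :> R by rewrite natr1 ler_nat.
have p0 := pi_gt0 R; have j0 : 0 <= j%:R :> R by [].
have num0 : 0 < 2 * j%:R + 1 :> R by lra.
apply/andP; split; first by rewrite divr_gt0// mulr_gt0.
rewrite ltr_pdivrMr ?mulr_gt0// (_ : pi / 2 * _ = (2 * N%:R) * pi); last by field.
by rewrite ltr_pM2r//; lra.
Qed.

(* Pairs the angles y and pi/2 - y and uses
   1 / sin^2 y + 1 / cos^2 y = 4 / sin^2 (2 y). *)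
Lemma sum_inv_sin2_double N : (0 < N)%N ->
  \sum_(j < N.*2) (sin (odd_angle N.*2 j) ^+ 2)^-1 =
  4 * \sum_(j < N) (sin (odd_angle N j) ^+ 2)^-1.
Proof.
move=> N0; have NR : N%:R != 0 :> R by rewrite pnatr_eq0 -lt0n.
have [s0 c0] : (forall j, (j < N)%N -> sin (odd_angle N.*2 j) != 0) /\
    (forall j, (j < N)%N -> cos (odd_angle N.*2 j) != 0).
  split=> j jN; have jN2 : (j < N.*2)%N by rewrite (leq_trans jN)// -addnn leq_addr.
    by rewrite gt_eqF// sin_gt0_pihalf// odd_angle_itv.
  have /andP[a0 a1] := odd_angle_itv jN2.
  by rewrite gt_eqF// cos_gt0_pihalf// a1 andbT; have := pi_gt0 R; lra.
set A := odd_angle N.*2 in s0 c0 *.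
rewrite -addnn big_split_ord /= [X in _ + X](reindex_inj rev_ord_inj) /=.
rewrite -big_split mulr_sumr /=; apply: eq_bigr => -[j jN] _ /=.
have -> : A (N + (N - j.+1))%N = pi / 2 - A j.
  rewrite /A /odd_angle natrD natrB// -natr1 -mul2n natrM; field.
  by rewrite NR.
have -> : odd_angle N j = A j *+ 2.
  by rewrite /A /odd_angle -mul2n natrM -mulr_natr; field; rewrite NR.
rewrite sin_mulr2n sinB sin_pihalf cos_pihalf mul1r mul0r subr0.
have := s0 _ jN; have := c0 _ jN; have := cos2Dsin2 (A j).
move: (sin _) (cos _) => s c e cn0 sn0.
have -> : (s ^+ 2)^-1 + (c ^+ 2)^-1 = (c ^+ 2 + s ^+ 2) / (s ^+ 2 * c ^+ 2).
  by field; rewrite cn0 sn0.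
by rewrite e -mulr_natr; field; rewrite cn0 sn0.
Qed.

(** Starting from 1 / sin^2 (pi / 4) = 2, each doubling of the number of angles multiplies the sum
    by 4. Powers of 2 are enough, since the limit is only needed along a subsequence. *)
Lemma sum_inv_sin2 m :
  \sum_(j < 2 ^ m) (sin (odd_angle (2 ^ m) j) ^+ 2)^-1 = 2 * (2 ^+ m) ^+ 2.
Proof.
elim: m => [|m IH].
  rewrite big_ord1 /odd_angle !expr0 mulr0 add0r mul1r expr1n !mulr1.
  have := cos2Dsin2 (pi / 4 : R); have := cos_mulr2n (pi / 4 : R).
  have -> : (pi / 4) *+ 2 = pi / 2 :> R by rewrite -mulr_natr; field.
  rewrite cos_pihalf mulr2n => e1 e2.
  have -> : sin (pi / 4) ^+ 2 = 2^-1 :> R by lra.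
  by rewrite invrK.
rewrite expnS mul2n sum_inv_sin2_double ?expn_gt0// IH (exprS _ m); ring.
Qed.

Definition odd_sum N : R := \sum_(j < N) ((2 * j%:R + 1) ^+ 2)^-1.
Definition sqr_sum N : R := \sum_(j < N) (j.+1%:R ^+ 2)^-1.

Lemma odd_sum_bounds m :
  pi ^+ 2 / 8 - pi ^+ 2 / 16 * (2 ^+ m)^-1 <= odd_sum (2 ^ m) <= pi ^+ 2 / 8.
Proof.
set N := (2 ^ m)%N; have N0 : 0 < 2 ^+ m :> R by rewrite exprn_gt0.
have e : \sum_(j < N) (odd_angle N j ^+ 2)^-1 =
    16 * (2 ^+ m) ^+ 2 / pi ^+ 2 * odd_sum N.
  rewrite mulr_sumr; apply: eq_bigr => j _; rewrite /odd_angle natrX.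
  have pne : pi != 0 :> R by rewrite gt_eqF// pi_gt0.
  have jne : 2 * j%:R + 1 != 0 :> R by rewrite gt_eqF// ltr_wpDl// mulr_ge0.
  have mne : 2 ^+ m != 0 :> R by rewrite gt_eqF.
  by move: (pi : R) pne => p pne; field; rewrite pne jne mne.
have up : \sum_(j < N) (odd_angle N j ^+ 2)^-1 <= 2 * (2 ^+ m) ^+ 2.
  rewrite -sum_inv_sin2; apply: ler_sum => j _.
  by have /andP[] := inv_sqr_bounds (odd_angle_itv (ltn_ord j)).
have lo : 2 * (2 ^+ m) ^+ 2 - 2 ^+ m <= \sum_(j < N) (odd_angle N j ^+ 2)^-1.
  have -> : 2 ^+ m = \sum_(j < N) 1 :> R by rewrite sumr_const card_ord natrX.
  rewrite {1}sumr_const card_ord natrX -sum_inv_sin2 -sumrB; apply: ler_sum => j _.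
  by have /andP[] := inv_sqr_bounds (odd_angle_itv (ltn_ord j)).
move: up lo; rewrite e; set O := odd_sum N; have := pi_gt0 R.
move: (pi : R) (2 ^+ m : R) N0 => p q q0 p0 up lo.
have K0 : 0 < 16 * q ^+ 2 / p ^+ 2 by rewrite divr_gt0 ?mulr_gt0 ?exprn_gt0.
move: up lo; rewrite -!(ler_pdivlMl _ _ K0) -!(ler_pdivrMl _ _ K0) => up lo.
have -> : p ^+ 2 / 8 - p ^+ 2 / 16 / q = (16 * q ^+ 2 / p ^+ 2)^-1 * (2 * q ^+ 2 - q).
  by field; rewrite !gt_eqF.
have -> : p ^+ 2 / 8 = (16 * q ^+ 2 / p ^+ 2)^-1 * (2 * q ^+ 2).
  by field; rewrite !gt_eqF.
by rewrite up lo.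
Qed.

Lemma sqr_sum_split N : sqr_sum N.*2 = odd_sum N + sqr_sum N / 4.
Proof.
elim: N => [|N IH]; first by rewrite /sqr_sum /odd_sum !big_ord0 mul0r addr0.
rewrite /sqr_sum doubleS !big_ord_recr /= -/(sqr_sum N.*2) IH.
rewrite /odd_sum big_ord_recr /= -/(odd_sum N) -!natr1 -mul2n natrM /sqr_sum.
have n0 : 0 <= N%:R :> R by [].
by field; rewrite !gt_eqF//=; lra.
Qed.

(** Telescopes 1 / (k + 1)^2 <= 1 / k - 1 / (k + 1). *)
Lemma sqr_sum_le2 N : sqr_sum N.+1 <= 2 - N.+1%:R^-1.
Proof.
elim: N => [|N IH]; first by rewrite /sqr_sum big_ord1 expr1n invr1; lra.
rewrite /sqr_sum big_ord_recr /= -/(sqr_sum N.+1).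
apply: (le_trans (lerD IH (lexx _))).
have n0 : 0 < N.+1%:R :> R by [].
rewrite -(natr1 N.+1) -subr_ge0.
have -> : 2 - (N.+1%:R + 1)^-1 - (2 - N.+1%:R^-1 + ((N.+1%:R + 1) ^+ 2)^-1) =
    (N.+1%:R * (N.+1%:R + 1) ^+ 2)^-1 :> R.
  by field; rewrite !gt_eqF//; lra.
by rewrite invr_ge0 mulr_ge0 ?sqr_ge0// ltW.
Qed.

(** Monotonicity and boundedness give a limit [l]. Along [2 ^ m] the sum over odd squares tends both
    to [l - l / 4] and to [pi ^+ 2 / 8], which determines [l]. *)
Lemma basel : sqr_sum n @[n --> \oo] --> (pi ^+ 2 / 6 : R).
Proof.
have cv : cvgn sqr_sum.
  apply: nondecreasing_is_cvgn.
    apply/nondecreasing_seqP => n; rewrite /sqr_sum big_ord_recr /= lerDl.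
    by rewrite invr_ge0 sqr_ge0.
  exists 2 => _ [[|n] _ <-]; first by rewrite /sqr_sum big_ord0.
  by apply: (le_trans (sqr_sum_le2 n)); rewrite gerBl invr_ge0.
case/cvg_ex: cv => l ul.
have expn_oo : (2 ^ m)%N @[m --> \oo] --> \oo.
  move=> A [N _ NA]; exists N => // m /= Nm; apply: NA => /=.
  exact: leq_trans Nm (ltnW (ltn_expl m _)).
have sub1 : sqr_sum (2 ^ m) @[m --> \oo] --> l by apply: cvg_comp ul.
have sub2 : sqr_sum (2 ^ m).*2 @[m --> \oo] --> l.
  have := sub1; rewrite -(cvg_shiftS (fun m => sqr_sum (2 ^ m))).
  by apply: cvg_trans; apply: near_eq_cvg; apply: nearW => m /=; rewrite expnS mul2n.
have odd1 : odd_sum (2 ^ m) @[m --> \oo] --> l - l / 4.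
  have -> : (fun m => odd_sum (2 ^ m)) =
      (fun m => sqr_sum (2 ^ m).*2 - sqr_sum (2 ^ m) / 4).
    by apply/funext => m; rewrite sqr_sum_split addrK.
  by apply: cvgB => //; apply: cvgMl.
have odd2 : odd_sum (2 ^ m) @[m --> \oo] --> (pi ^+ 2 / 8 : R).
  apply: (@squeeze_cvgr _ _ _ _ (fun m => pi ^+ 2 / 8 - pi ^+ 2 / 16 * (2 ^+ m)^-1)
    (fun=> pi ^+ 2 / 8)); [exact/nearW/odd_sum_bounds| |exact: cvg_cst].
  rewrite -[X in _ --> X]subr0 -[X in _ --> _ - X](mulr0 (pi ^+ 2 / 16)).
  apply: cvgB; first exact: cvg_cst.
  apply: cvgMr; have h : `|2^-1 : R| < 1 by rewrite ger0_norm// invf_lt1// ltr1n.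
  have -> : (fun m => (2 ^+ m)^-1) = GRing.exp (2^-1 : R).
    by apply/funext => m; rewrite exprVn.
  exact: cvg_expr h.
have e : l - l / 4 = pi ^+ 2 / 8 by exact: cvg_unique odd1 odd2.
have solve (p q : R) : q - q / 4 = p / 8 -> p / 6 = q by move=> ?; lra.
by rewrite (solve _ _ e).
Qed.

End Basel.

(** * From K to the surviving columns *)

Section SurvivalPerturbation.
Variable R : realType.
Implicit Types (n k : nat).

Lemma harmonic01 k : 0 <= (harmonic k : R) <= 1.
Proof. by rewrite harmonic_ge0/= invf_le1 ?ltr0n// ler1n. Qed.

(** By independence the expectation is the product of the [1 - (1 - a) * p i], and 1 + x <= exp x
    bounds each factor. *)
Lemma bern_exp_le (p : nat -> R) (a : R) n : (forall i, 0 <= p i <= 1) ->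
  0 <= a <= 1 ->
  0 <= bern p n (fun k => a ^+ k) <= expR (- ((1 - a) * bern_mean p n)).
Proof.
move=> p01 /andP[a0 a1]; elim: n => [|n IH] /=.
  by rewrite /bern_mean big_ord0 mulr0 oppr0 expR0 lexx ler01.
have /andP[p0 p1] := p01 n; case/andP: IH => b0 b1.
rewrite (@eq_bern _ _ _ _ (fun k => a * a ^+ k)); last by move=> k /=; rewrite exprS.
rewrite bernZ /bern_mean big_ord_recr /= -/(bern_mean p n).
set B := bern p n _ in b0 b1 *.
have -> : p n * (a * B) + (1 - p n) * B = (1 - (1 - a) * p n) * B by ring.
have c0 : 0 <= 1 - (1 - a) * p n by nra.
rewrite mulr_ge0//= mulrDr opprD expRD [leRHS]mulrC ler_pM//.
exact: expR_ge1Dx.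
Qed.

Definition decay n : R := expR (- (bern_mean harmonic n / 4)).

Lemma decay_ge0 n : 0 <= decay n. Proof. exact: expR_ge0. Qed.

Lemma decay_mul_le (t : R) : 0 < t -> expR (- (t / 4)) * t <= 64 / t.
Proof.
move=> t0; have e8 : t / 8 <= expR (t / 8).
  by apply: le_trans (expR_ge1Dx _); rewrite lerDr.
have e4 : expR (t / 4) = expR (t / 8) ^+ 2.
  by rewrite expr2 -expRD; congr expR; field.
rewrite expRN e4 mulrC ler_pdivrMr ?exprn_gt0 ?expR_gt0//.
have : (t / 8) ^+ 2 <= expR (t / 8) ^+ 2 by rewrite lerXn2r// nnegrE ?expR_ge0// divr_ge0// ltW.
move: (expR _ ^+ 2) => y le_y; rewrite mulrAC ler_pdivlMr//; lra.
Qed.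

Lemma sqr_exp2_le_exp3 k : ((k ^ 2 + 1) * 2 ^ k <= 5 * 3 ^ k)%N.
Proof.
(* The induction step needs 2 ((k + 1)^2 + 1) <= 3 (k^2 + 1), which holds exactly from k = 5 on; the
   values up to 5 are computed. *)
have [k5|k5] := leqP k 4; first by case: k k5 => [|[|[|[|[|]]]]].
elim: k k5 => // k IH; rewrite ltnS leq_eqVlt => /orP[/eqP<-//|k5].
have {}IH := IH k5; rewrite !expnS; rewrite !expnS expn0 in IH *.
by move: (2 ^ k)%N (3 ^ k)%N IH => u v; nia.
Qed.

Lemma agree_prob_ge0 k : 0 <= agree_prob R k.
Proof. by rewrite divr_ge0// exprn_ge0. Qed.

Lemma agree_prob_sqr_le k : agree_prob R k * (k%:R ^+ 2 + 1) <= 10 * (3 / 4) ^+ k.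
Proof.
have := sqr_exp2_le_exp3 k; rewrite -(ler_nat R) !natrM natrD !natrX => le.
have p2 : 0 < 2 ^+ k :> R by rewrite exprn_gt0.
rewrite /agree_prob mulrAC ler_pdivrMr// expr_div_n.
have -> : 4 ^+ k = 2 ^+ k * 2 ^+ k :> R by rewrite -exprMn; congr (_ ^+ _); rewrite -natrM.
have -> : 10 * (3 ^+ k / (2 ^+ k * 2 ^+ k)) * 2 ^+ k = 10 * 3 ^+ k / 2 ^+ k :> R.
  by field; rewrite gt_eqF.
by rewrite ler_pdivlMr//; lra.
Qed.

(** [surv h k - h k] is [agree_prob R k * (h 1%N - h k)], and the geometric decay of [agree_prob]
    absorbs quadratic growth of [h]. *)
Lemma surv_close n (h : nat -> R) (M : R) : 0 <= M ->
  (forall k, `|h 1%N - h k| <= M * (k%:R ^+ 2 + 1)) ->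
  `|bern harmonic n (surv h) - bern harmonic n h| <= 10 * M * decay n.
Proof.
move=> M0 hM; have geo := @bern_exp_le harmonic (3 / 4) n harmonic01.
have {}/geo /andP[_ geo] : 0 <= (3 / 4 : R) <= 1 by lra.
have {}geo : bern harmonic n (fun k => (3 / 4) ^+ k) <= decay n.
  by apply: (le_trans geo); rewrite ler_expR; lra.
apply: (@le_trans _ _ (bern harmonic n (fun k => (10 * M) * (3 / 4) ^+ k))); last first.
  by rewrite bernZ ler_wpM2l// mulr_ge0.
have le k : `|surv h k - h k| <= (10 * M) * (3 / 4) ^+ k.
  rewrite (_ : surv h k - h k = agree_prob R k * (h 1%N - h k)); last by rewrite /surv; ring.
  rewrite normrM ger0_norm ?agree_prob_ge0//.
  apply: (le_trans (ler_wpM2l (agree_prob_ge0 k) (hM k))).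
  have := ler_wpM2l M0 (agree_prob_sqr_le k); lra.
rewrite -bernB ler_norml; apply/andP; split; last first.
  by apply: (ler_bern harmonic01) => k; have := le k; rewrite ler_norml => /andP[].
rewrite lerNl -mulN1r -bernZ; apply: (ler_bern harmonic01) => k.
by have := le k; rewrite ler_norml mulN1r lerNl => /andP[].
Qed.

Lemma mean_SC_close n : (0 < n)%N ->
  `|mean_SC R 2 n - bern_mean harmonic n| <= 10 * decay n.
Proof.
move=> n0; rewrite mean_SCE// -(bern_id harmonic n) -[10]mulr1.
apply: surv_close => // k; rewrite mul1r ler_norml.
have k0 : (0 : R) <= k%:R by []; have := sqr_ge0 (k%:R - 1 : R); nra.
Qed.

Lemma var_SC_close n : (0 < n)%N ->
  `|var_SC R 2 n - bern_var harmonic n|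
    <= 30 * decay n + 20 * (decay n * bern_mean harmonic n) + 300 * (decay n * decay n).
Proof.
move=> n0; rewrite var_SCE//; set m := mean_SC R 2 n; set H := bern_mean harmonic n.
have H0 : 0 <= H by apply: sumr_ge0 => i _; exact: harmonic_ge0.
have := mean_SC_close n0; rewrite -/m -/H => mH.
have e0 := decay_ge0 n.
(* The variance is centred at [m], the mean after elimination, and not at the mean [H] of [K]; the
   shift costs [(H - m) ^+ 2]. *)
have center : bern harmonic n (fun k => (k%:R - m) ^+ 2) = bern_var harmonic n + (H - m) ^+ 2.
  rewrite (@eq_bern _ _ _ _ ((fun k => (k%:R - H) ^+ 2) \+
    (fun k => (2 * (H - m)) * (k%:R - H) - - (H - m) ^+ 2))).
    rewrite bernD bern_center2 bernB bernZ bernB bern_id !bern_cst -/H.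
    ring.
  by move=> k /=; ring.
have := @surv_close n (fun k => (k%:R - m) ^+ 2) (1 + 2 * `|m|).
have M0 : 0 <= 1 + 2 * `|m| by rewrite addr_ge0// mulr_ge0.
move=> /(_ M0) close; rewrite center in close.
have {}close := close _.
have mle : `|m| <= H + 10 * decay n.
  by rewrite -[m](subrK H) (le_trans (ler_normD _ _))// (ger0_norm H0) addrC lerD2l.
have sq : (H - m) ^+ 2 <= (10 * decay n) ^+ 2.
  by rewrite -(real_normK (num_real (H - m))) distrC lerXn2r// nnegrE// mulr_ge0.
have sq0 := sqr_ge0 (H - m).
have le : `|bern harmonic n (surv (fun k => (k%:R - m) ^+ 2)) -
    (bern_var harmonic n + (H - m) ^+ 2)| <= 10 * (1 + 2 * `|m|) * decay n.
  apply: close => k; rewrite subr_sqr.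
  rewrite (_ : _ * _ = (1 - k%:R ^+ 2) - (2 * m) * (1 - k%:R)); last by ring.
  apply: (le_trans (ler_normB _ _)); rewrite !normrM mulrDl mul1r (ger0_norm (_ : 0 <= 2))//.
  have k0 : (0 : R) <= k%:R by []; have ks := sqr_ge0 (k%:R - 1 : R).
  apply: lerD; first by rewrite ler_norml; nra.
  by rewrite ler_wpM2l ?mulr_ge0// ler_norml; nra.
have md : `|m| * decay n <= (H + 10 * decay n) * decay n by rewrite ler_wpM2r.
by move: le; rewrite !ler_norml => /andP[l1 l2]; apply/andP; split; nra.
Qed.

Lemma prob_SC_close n (P : pred R) : (0 < n)%N ->
  `|fine (random_game R 2 n [set g | P (SC R g)]) -
    bern harmonic n (fun k => (P k%:R)%:R)| <= 10 * decay n.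
Proof.
move=> n0; rewrite prob_SCE// -[10]mulr1; apply: surv_close => // k.
have k2 := sqr_ge0 (k%:R : R).
case: (P _); case: (P _); rewrite ?subrr ?subr0 ?sub0r ?normrN ?normr0 ?normr1 mul1r; try lra.
Qed.

End SurvivalPerturbation.

(** * Stability of [Phi] under shifts and rescaling *)

Section PhiScale.
Variable R : realType.
Implicit Types (x y r s : R).

Lemma Phi_dist x y : `|Phi x - Phi y| <= `|x - y|.
Proof.
have [xy|/ltW yx] := leP x y.
  rewrite distrC (distrC x) ger0_norm ?subr_ge0 ?Phi_homo//.
  by rewrite ger0_norm ?subr_ge0// Phi_lipschitz.
by rewrite ger0_norm ?subr_ge0 ?Phi_homo// ger0_norm ?subr_ge0// Phi_lipschitz.
Qed.

(** The difference is [phi c * |r - 1| * |x|] with [c] between [x] and [r * x]. As [r] is at least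
    1/2, [|x| <= 2 * |c|], and [|c| * phi c <= 1] removes the dependence on [x]. *)
Lemma Phi_dist_scale r x : 2^-1 <= r -> `|Phi (r * x) - Phi x| <= 2 * `|r - 1|.
Proof.
move=> r2.
have main y z c : `|x| <= 2 * `|c| -> z - y = `|r - 1| * `|x| ->
    phi c * (z - y) <= 2 * `|r - 1|.
  move=> xc ->; rewrite mulrCA mulrC ler_wpM2r//.
  have := abs_phi_le1 c; have := ler_wpM2l (phi_ge0 c) xc; lra.
have dist : `|r * x - x| = `|r - 1| * `|x| by rewrite -normrM mulrBl mul1r.
have half c : (r * x <= c <= x) || (x <= c <= r * x) -> `|x| <= 2 * `|c|.
  have [x0|x0] := leP 0 x => h.
    have c0 : 2^-1 * x <= c.
      by case/orP: h => /andP[h1 h2]; nra.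
    by rewrite (ger0_norm x0) (ger0_norm (_ : 0 <= c)); lra.
  have c0 : c <= 2^-1 * x by case/orP: h => /andP[h1 h2]; nra.
  by rewrite (ltr0_norm x0) (ler0_norm (_ : c <= 0)); lra.
have [le|/ltW le] := leP (r * x) x.
  have [c cc e] := Phi_mvt le; rewrite distrC e ger0_norm ?mulr_ge0 ?phi_ge0 ?subr_ge0//.
  by apply: main; [apply: half; rewrite cc
    | rewrite -dist distrC ger0_norm ?subr_ge0].
have [c cc e] := Phi_mvt le; rewrite e ger0_norm ?mulr_ge0 ?phi_ge0 ?subr_ge0//.
by apply: main; [apply: half; rewrite cc orbT
    | rewrite -dist ger0_norm ?subr_ge0].
Qed.

End PhiScale.

(** * Asymptotics *)

Section Asymptotics.
Variable R : realType.
Implicit Types (n : nat).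

Local Notation L n := (ln n%:R : R).
Local Notation H n := (bern_mean harmonic n : R).
Local Notation V n := (bern_var harmonic n : R).

Lemma near_ln_ge (A : R) : \forall n \near \oo, A <= L n.
Proof.
near=> n; rewrite -[A]expRK ler_ln ?posrE ?expR_gt0//.
  by near: n; exact: nbhs_infty_ger.
by apply: lt_le_trans (expR_gt0 A) _; near: n; exact: nbhs_infty_ger.
Unshelve. all: by end_near. Qed.

Lemma ln_le_mean n : L n <= H n.
Proof. by rewrite bern_mean_harmonic ln_le_harmonic. Qed.

Lemma cvg_mean_sub_ln : H n - L n @[n --> \oo] --> euler_mascheroni R.
Proof.
rewrite (_ : (fun n => H n - L n) = (fun n => series harmonic n - L n)).
  exact: cvg_euler_mascheroni.
by apply/funext => n; rewrite bern_mean_harmonic.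
Qed.

Lemma bern_varE n : V n = H n - sqr_sum R n.
Proof.
rewrite /bern_var /bern_mean /sqr_sum -sumrB; apply: eq_bigr => i _.
by rewrite /= mulrBr mulr1 -exprVn expr2.
Qed.

Lemma near_decay_mean_le (e : R) : 0 < e -> \forall n \near \oo, decay R n * H n <= e.
Proof.
move=> e0; near=> n.
have Hn : 64 / e <= H n.
  by apply: le_trans (ln_le_mean n); near: n; exact: near_ln_ge.
have H0 : 0 < H n by apply: lt_le_trans Hn; rewrite divr_gt0.
apply: le_trans (decay_mul_le H0) _; rewrite ler_pdivrMr//.
by rewrite mulrC -ler_pdivrMr.
Unshelve. all: by end_near. Qed.

Lemma cvg_decay_mean : decay R n * H n @[n --> \oo] --> (0 : R).
Proof.
apply/cvgr0Pnorm_le => e e0; near=> n.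
have H0 : 0 <= H n by apply: sumr_ge0 => i _; exact: harmonic_ge0.
rewrite ger0_norm ?mulr_ge0 ?decay_ge0//.
by near: n; exact: near_decay_mean_le.
Unshelve. all: by end_near. Qed.

Lemma near_decay_le : \forall n \near \oo, decay R n <= decay R n * H n.
Proof.
near=> n; rewrite ler_peMr ?decay_ge0//; apply: le_trans (ln_le_mean n).
by near: n; exact: near_ln_ge.
Unshelve. all: by end_near. Qed.

Lemma cvg_decay : decay R n @[n --> \oo] --> (0 : R).
Proof.
apply: (@squeeze_cvgr _ _ _ _ (fun=> 0) (fun n => decay R n * H n)).
- near=> n; rewrite decay_ge0/=.
  by near: n; exact: near_decay_le.
- exact: cvg_cst.
- exact: cvg_decay_mean.
Unshelve. all: by end_near. Qed.

Lemma cvg0_of_norm_le (f g : nat -> R) : (\forall n \near \oo, `|f n| <= g n) ->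
  g n @[n --> \oo] --> (0 : R) -> f n @[n --> \oo] --> (0 : R).
Proof.
move=> fg g0; apply: (@squeeze_cvgr _ _ _ _ (fun n => - g n) g) => //.
  by apply: filterS fg => n; rewrite ler_norml.
by rewrite -oppr0; exact: cvgN.
Qed.

Lemma cvg_mean_SC : mean_SC R 2 n - H n @[n --> \oo] --> (0 : R).
Proof.
apply: (@cvg0_of_norm_le _ (fun n => 10 * decay R n)).
  by near=> n; apply: mean_SC_close; near: n; exact: nbhs_infty_gt.
by rewrite -[X in _ --> X](mulr0 10); apply: cvgMr; exact: cvg_decay.
Unshelve. all: by end_near. Qed.

Lemma cvg_var_SC : var_SC R 2 n - V n @[n --> \oo] --> (0 : R).
Proof.
apply: (@cvg0_of_norm_le _ (fun n => 30 * decay R n + 20 * (decay R n * H n) +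
    300 * (decay R n * decay R n))).
  by near=> n; apply: var_SC_close; near: n; exact: nbhs_infty_gt.
rewrite (_ : 0 = 30 * 0 + 20 * 0 + 300 * (0 * 0)); last by ring.
apply: cvgD; [apply: cvgD|]; apply: cvgMr.
- exact: cvg_decay.
- exact: cvg_decay_mean.
- by apply: cvgM; exact: cvg_decay.
Unshelve. all: by end_near. Qed.

Lemma cvg_mean_SC_sub_ln :
  mean_SC R 2 n - (L n + euler_mascheroni R) @[n --> \oo] --> (0 : R).
Proof.
have -> : (fun n => mean_SC R 2 n - (L n + euler_mascheroni R)) =
    (fun n => (mean_SC R 2 n - H n) + ((H n - L n) - euler_mascheroni R)).
  by apply/funext => n; ring.
rewrite -[X in _ --> X]addr0 -[X in _ --> _ + X](subrr (euler_mascheroni R)).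
apply: cvgD; first exact: cvg_mean_SC.
by apply: cvgB; [exact: cvg_mean_sub_ln | exact: cvg_cst].
Qed.

Lemma cvg_var_SC_sub_ln :
  var_SC R 2 n - L n @[n --> \oo] --> (euler_mascheroni R - pi ^+ 2 / 6 : R).
Proof.
have -> : (fun n => var_SC R 2 n - L n) =
    (fun n => (var_SC R 2 n - V n) + ((H n - L n) - sqr_sum R n)).
  by apply/funext => n; rewrite bern_varE; ring.
rewrite -[X in _ --> X]add0r; apply: cvgD; first exact: cvg_var_SC.
by apply: cvgB; [exact: cvg_mean_sub_ln | exact: basel].
Qed.

(** The inverse squares sum to at most 2, so the variance of [K] is at least [L n - 2]; the
    threshold 4 makes this at least [L n / 2]. *)
Lemma near_var_bounds : \forall n \near \oo,
  [/\ 4 <= L n, L n / 2 <= V n & `|var_SC R 2 n - V n| <= 1].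
Proof.
near=> n; have L4 : 4 <= L n by near: n; exact: near_ln_ge.
split => //.
- have Q2 : sqr_sum R n <= 2.
    case: (n) => [|k]; first by rewrite /sqr_sum big_ord0.
    by apply: (le_trans (sqr_sum_le2 R k)); rewrite gerBl invr_ge0.
  rewrite bern_varE; have := ln_le_mean n; lra.
- by near: n; apply: (cvgr0_norm_le _ cvg_var_SC).
Unshelve. all: by end_near. Qed.

Lemma sqrt_sub_le (a b : R) : 0 < b -> 0 <= a ->
  `|Num.sqrt a / Num.sqrt b - 1| <= `|a - b| / b.
Proof.
move=> b0 a0; have sb : 0 < Num.sqrt b by rewrite sqrtr_gt0.
set r := Num.sqrt a / Num.sqrt b; have r0 : 0 <= r by rewrite divr_ge0.
have -> : `|a - b| / b = `|r - 1| * (r + 1).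
  have r1 : `|r + 1| = r + 1 by rewrite ger0_norm// addr_ge0.
  rewrite -[X in _ = _ * X]r1 -normrM.
  have -> : (r - 1) * (r + 1) = (a - b) / b.
    rewrite -subr_sqr_1 /r expr_div_n !sqr_sqrtr ?(ltW b0)//.
    by field; rewrite gt_eqF.
  by rewrite normrM normfV (gtr0_norm b0).
by rewrite ler_peMr// lerDr.
Qed.

Lemma var_SC_ge0_of (v w : R) : 2 <= v -> `|w - v| <= 1 -> 0 <= w /\ 2^-1 <= w / v.
Proof.
move=> v2; rewrite ler_norml => /andP[h1 h2]; split; first by lra.
by rewrite ler_pdivlMr; lra.
Qed.

Lemma berry_esseen_SC : exists K : R, \forall n \near \oo, forall x : R,
  `| fine (random_game R 2 n
       [set g | SC R g - mean_SC R 2 n <= x * Num.sqrt (var_SC R 2 n)])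
     - Phi x | <= K / Num.sqrt (L n).
Proof.
(* The four terms pay for passing from S^C to [K], for Berry-Esseen with [sV^-1 <= 2 / l], for the
   scale [r] and for the shift [t]. *)
pose B := stein_bound R; exists (10 + 2 * (B + 3) + 4 + 2); near=> n => x.
have n0 : (0 < n)%N by near: n; exact: nbhs_infty_gt.
have [L4 VL vV] : [/\ 4 <= L n, L n / 2 <= V n & `|var_SC R 2 n - V n| <= 1].
  by near: n; exact: near_var_bounds.
have eH : decay R n * H n <= 1 by near: n; exact: near_decay_mean_le.
have mH : `|mean_SC R 2 n - H n| <= 1 by near: n; apply: (cvgr0_norm_le _ cvg_mean_SC).
have V0 : 0 < V n by lra.
have [w0 wV] := @var_SC_ge0_of (V n) (var_SC R 2 n) ltac:(lra) vV.
set m := mean_SC R 2 n in mH *; set s := Num.sqrt (var_SC R 2 n).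
pose sV := Num.sqrt (V n); pose l := Num.sqrt (L n).
have sV0 : 0 < sV by rewrite sqrtr_gt0.
have l0 : 0 < l by rewrite sqrtr_gt0; lra.
have l2 : l * l = L n by rewrite -expr2 sqr_sqrtr//; lra.
have l1 : 1 <= l by rewrite -sqrtr1 ler_sqrt//; lra.
have isV : sV^-1 <= 2 / l.
  rewrite ler_pdivlMr// mulrC ler_pdivrMr//.
  have : l ^+ 2 <= (2 * sV) ^+ 2 by rewrite exprMn !sqr_sqrtr; lra.
  by rewrite ler_sqr ?nnegrE ?mulr_ge0 ?(ltW sV0) ?(ltW l0).
have iL : (L n)^-1 <= l^-1 by rewrite lef_pV2 ?posrE// -l2 ?mulr_gt0// ler_peMr// ltW.
have e1 : 10 * decay R n <= 10 / l.
  rewrite ler_wpM2l//; apply: le_trans iL.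
  rewrite -div1r ler_pdivlMr; last by lra.
  by apply: le_trans eH; rewrite ler_wpM2l ?decay_ge0// ln_le_mean.
pose r := s / sV; pose t := (m - H n) / sV.
have r2 : 2^-1 <= r.
  have r0 : 0 <= r by apply: divr_ge0; exact: sqrtr_ge0.
  have : 2^-1 <= r ^+ 2 by rewrite expr_div_n !sqr_sqrtr// ltW.
  nra.
have dr : `|r - 1| <= 2 / l.
  apply: (le_trans (sqrt_sub_le V0 w0)); rewrite ler_pdivrMr//.
  apply: (le_trans vV); apply: (@le_trans _ _ (2 / l * (L n / 2))); last first.
    by rewrite ler_wpM2l// divr_ge0// ltW.
  by rewrite -l2 (_ : 2 / l * _ = l)//; field; rewrite gt_eqF.
have dt : `|t| <= 2 / l.
  rewrite normrM normfV (gtr0_norm sV0); apply: le_trans isV.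
  by rewrite ler_piMl// invr_ge0 ltW.
pose P := [pred y : R | y - m <= x * s].
have d1 := prob_SC_close P n0.
have d2 := @bern_berry_esseen R harmonic (@harmonic01 R) n V0 (r * x + t).
have d3 := Phi_dist (r * x + t) (r * x); have d4 := Phi_dist_scale x r2.
(* The same event, restandardised by the mean and deviation of [K]. *)
have prob_eq : bern harmonic n (fun k => (P k%:R)%:R) =
    bern harmonic n (fun k => ((k%:R - H n) / sV <= r * x + t)%R%:R) :> R.
  apply: eq_bern => k; congr (nat_of_bool _)%:R; rewrite /= /r /t.
  rewrite ler_pdivrMr//.
  have -> : (s / sV * x + (m - H n) / sV) * sV = x * s + (m - H n).
    by field; rewrite gt_eqF.
  by rewrite -lerBlDr; congr (_ <= _); ring.
rewrite -prob_eq in d2; rewrite addrAC subrr add0r in d3.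
have d2' : (B + 3) / sV <= (B + 3) * (2 / l).
  by rewrite ler_wpM2l// addr_ge0// (le_trans _ (stein_bound_ge1 R)).
rewrite -[X in `|X - _|]/(fine (random_game R 2 n [set g | P (SC R g)])) -/l.
have -> : (10 + 2 * (B + 3) + 4 + 2) / l =
  10 / l + (B + 3) * (2 / l) + 2 * (2 / l) + 2 / l by field; rewrite gt_eqF.
move: d1 d2 d3 d4 dr dt e1 d2'; rewrite -/sV -/B.
move: (fine _) (bern _ _ _) (Phi _) (Phi _) (Phi _) => p q a b c.
move: ((B + 3) * (2 / l)) => u1; move: (2 / l) (10 / l) => u2 u3.
move: (10 * decay R n) ((B + 3) / sV) `|t| `|r - 1| => u4 u5 u6 u7.
by rewrite !ler_norml => *; apply/andP; split; lra.
Unshelve. all: by end_near. Qed.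

Lemma cvg_sqrt_var :
  (Num.sqrt (var_SC R 2 n) - Num.sqrt (L n)) * Num.sqrt (L n) @[n --> \oo] -->
    ((euler_mascheroni R - pi ^+ 2 / 6) / 2 : R).
Proof.
set b := euler_mascheroni R - pi ^+ 2 / 6.
(* The rationalised form of the product in the goal: the numerator tends to [b], the denominator to
   2. *)
pose f n := (var_SC R 2 n - L n) / (Num.sqrt (var_SC R 2 n / L n) + 1).
have ratio : var_SC R 2 n / L n @[n --> \oo] --> (1 : R).
  have iL : (L n)^-1 @[n --> \oo] --> (0 : R).
    apply/cvgr0Pnorm_le => e e0; near=> n.
    have Ln : e^-1 <= L n by near: n; exact: near_ln_ge.
    have L0 : 0 < L n by apply: lt_le_trans Ln; rewrite invr_gt0.
    by rewrite gtr0_norm ?invr_gt0// -[leRHS]invrK lef_pV2// posrE invr_gt0.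
  have : (var_SC R 2 n - L n) * (L n)^-1 + 1 @[n --> \oo] --> (b * 0 + 1 : R).
    by apply: cvgD; [apply: cvgM => //; exact: cvg_var_SC_sub_ln | exact: cvg_cst].
  rewrite mulr0 add0r; apply: cvg_trans; apply: near_eq_cvg; near=> n.
  have L1 : 1 <= L n by near: n; exact: near_ln_ge.
  by rewrite mulrBl divff ?subrK// gt_eqF//; lra.
have cf : f n @[n --> \oo] --> (b / 2 : R).
  apply: cvgM; first exact: cvg_var_SC_sub_ln.
  have d : Num.sqrt (var_SC R 2 n / L n) + 1 @[n --> \oo] --> (Num.sqrt 1 + 1 : R).
    apply: cvgD; last exact: cvg_cst.
    by apply: continuous_cvg => //; exact: sqrt_continuous.
  rewrite sqrtr1 in d; apply: cvgV; last exact: d.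
  by rewrite gt_eqF.
apply: cvg_trans cf; apply: near_eq_cvg; near=> n.
have [L4 VL vV] : [/\ 4 <= L n, L n / 2 <= V n & `|var_SC R 2 n - V n| <= 1].
  by near: n; exact: near_var_bounds.
have [w0 _] := @var_SC_ge0_of (V n) (var_SC R 2 n) ltac:(lra) vV.
have l0 : 0 < Num.sqrt (L n) by rewrite sqrtr_gt0; lra.
have v0 := sqrtr_ge0 (var_SC R 2 n).
have L2 : Num.sqrt (L n) ^+ 2 = L n by rewrite sqr_sqrtr//; lra.
have w2 : Num.sqrt (var_SC R 2 n) ^+ 2 = var_SC R 2 n by rewrite sqr_sqrtr.
rewrite /f sqrtrM// sqrtrV; last by lra.
rewrite -{1}w2 -{1}L2; field; rewrite !gt_eqF//; lra.
Unshelve. all: by end_near. Qed.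

End Asymptotics.

Theorem proposition3 (R : realType) :
  [/\ exists K : R, \forall n \near \oo, forall x : R,
        `| fine (random_game R 2 n
             [set g | SC R g - mean_SC R 2 n <= x * Num.sqrt (var_SC R 2 n)])
           - Phi x | <= K / Num.sqrt (ln n%:R),
      (fun n : nat => mean_SC R 2 n - (ln n%:R + euler_mascheroni R))
        =o_\oo (fun _ : nat => 1 : R)
    & (fun n : nat => Num.sqrt (var_SC R 2 n)
         - (Num.sqrt (ln n%:R)
            - (pi ^+ 2 - 6 * euler_mascheroni R) / (12 * Num.sqrt (ln n%:R))))
        =o_\oo (fun n : nat => (Num.sqrt (ln n%:R))^-1 : R) ].
Proof.
split; first exact: berry_esseen_SC.
- apply/eqoP => e e0; have /cvgr0Pnorm_le/(_ _ e0) := @cvg_mean_SC_sub_ln R.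
  by apply: filterS => n; rewrite normr1 mulr1.
- apply/eqoP => e e0; have /cvgrPdist_le/(_ _ e0) near_e := @cvg_sqrt_var R.
  near=> n; set l := Num.sqrt (ln n%:R).
  have l0 : 0 < l.
    rewrite sqrtr_gt0; apply: (@lt_le_trans _ _ 1) => //.
    by near: n; exact: near_ln_ge.
  rewrite normfV (gtr0_norm l0) ler_pdivlMr// -[X in _ * X](gtr0_norm l0) -normrM.
  (* Multiplying by [l] turns the correction term into [(pi ^+ 2 - 6 * euler_mascheroni R) / 12],
     which is minus the limit in [cvg_sqrt_var]. *)
  rewrite (_ : (_ - (_ - _)) * l = (Num.sqrt (var_SC R 2 n) - l) * l
    - (euler_mascheroni R - pi ^+ 2 / 6) / 2); last first.
    by move: (pi : R) => p; field; rewrite gt_eqF.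
  by rewrite distrC /l; near: n; exact: near_e.
Unshelve. all: by end_near. Qed.
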